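(* Let $f(q,\overline q)=\sum_{j=0}^m\overline q^{\,j}\varphi_j(q)\in\mathcal{SR}_m$ and $g(q,\overline q)=\sum_{k=0}^n\overline q^{\,k}\psi_k(q)\in\mathcal{SR}_n$ with $\varphi_j,\psi_k\in\mathcal{SR}$. Then the function $$(f\odot^L_{sp}g)(q,\overline q)=\sum_{j=0}^m\sum_{k=0}^n\overline q^{\,j+k}\varphi_j(q)\psi_k(q)$$ is S-polyregular in each of the following cases: (1) the $\psi_k$, $k=0,1,\dots,n$, are right quaternionic polynomial functions; (2) $(\varphi_j)_I$ takes values in $\mathbb C_I$ for every $I\in\mathbb S$ and every $j=0,1,\dots,m$; (3) there exists a positive integer $k_0$ such that for every $j=0,1,\dots,m$ and $k=0,1,\dots,n$, $$G_{\varphi_j}\cdot\frac{\partial^{k_0}(\psi_k)_I}{\partial y^{k_0}}=0\quad\text{on }\mathbb C_I$$ for every $I\in\mathbb S$.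
   Context: $\mathbb H$ is the algebra of quaternions, $\mathbb S=\{I\in\mathbb H: I^2=-1\}$, and for $I\in\mathbb S$, $\mathbb C_I=\mathbb R+\mathbb R I$. For $f:\mathbb H\to\mathbb H$, $f_I=f|_{\mathbb C_I}$, regarded as a function of $(x,y)\in\mathbb R^2$ via $q=x+Iy$, and $\overline{\partial_I}=\frac12\left(\frac{\partial}{\partial x}+I\frac{\partial}{\partial y}\right)$, with $I$ acting by left multiplication. For a nonnegative integer $n$, $\mathcal{SR}_n$ (S-polyregular functions of level $n$) is the set of (sufficiently real differentiable) functions $f:\mathbb H\to\mathbb H$ with $\overline{\partial_I}^{\,n+1}f_I=0$ on $\mathbb C_I$ for every $I\in\mathbb S$; $\mathcal{SR}=\mathcal{SR}_0$ is the space of (left) slice regular functions on $\mathbb H$. A function is S-polyregular if it belongs to $\mathcal{SR}_n$ for some $n\ge 0$. A right quaternionic polynomial function is a function of the form $q\mapsto\sum_{m=0}^M q^m\beta_m$ with $\beta_m\in\mathbb H$. For $\varphi\in\mathcal{SR}$ and $I\perp J$ in $\mathbb S$, $G_\varphi$ denotes the component in the splitting $\varphi_I=F_\varphi+G_\varphi J$ with $F_\varphi,G_\varphi:\mathbb C_I\to\mathbb C_I$ holomorphic (such a splitting exists and is unique; the zero set of $G_\varphi$ does not depend on the choice of $J$). *)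

(* Defs.v *)
From Stdlib Require Import Reals.
From Coquelicot Require Import Coquelicot.

Open Scope R_scope.

(* The quaternion a + b i + c j + d k is the tuple (a, b, c, d).  Being an
   iterated product of R, the type inherits Coquelicot's real normed module
   structure (plus, opp, scal, zero, continuous, ex_derive, sum_n). *)
Definition quat : Type := (R * R * R * R)%type.

Definition qre (q : quat) : R := fst (fst (fst q)).
Definition qim_i (q : quat) : R := snd (fst (fst q)).
Definition qim_j (q : quat) : R := snd (fst q).
Definition qim_k (q : quat) : R := snd q.

Definition qreal (x : R) : quat := (x, 0, 0, 0).

Definition qconj (q : quat) : quat := (qre q, - qim_i q, - qim_j q, - qim_k q).

Definition qmul (p q : quat) : quat :=
  (qre p * qre q - qim_i p * qim_i q - qim_j p * qim_j q - qim_k p * qim_k q,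
   qre p * qim_i q + qim_i p * qre q + qim_j p * qim_k q - qim_k p * qim_j q,
   qre p * qim_j q - qim_i p * qim_k q + qim_j p * qre q + qim_k p * qim_i q,
   qre p * qim_k q + qim_i p * qim_j q - qim_j p * qim_i q + qim_k p * qre q).

Declare Scope quat_scope.
Delimit Scope quat_scope with H.
Bind Scope quat_scope with quat.
Notation "p + q" := (plus p q) : quat_scope.
Notation "p * q" := (qmul p q) : quat_scope.

Fixpoint qpow (q : quat) (n : nat) : quat :=
  match n with
  | O => qreal 1
  | S n' => (q * qpow q n')%H
  end.

Definition qdot (p q : quat) : R :=
  qre p * qre q + qim_i p * qim_i q + qim_j p * qim_j q + qim_k p * qim_k q.

Definition in_S (I : quat) : Prop := (I * I)%H = qreal (-1).

Definition perp (I J : quat) : Prop := qdot I J = 0.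

Definition slice_point (I : quat) (x y : R) : quat := (qreal x + scal y I)%H.

Definition in_CI (I q : quat) : Prop := exists x y : R, q = slice_point I x y.

Definition slice (I : quat) (f : quat -> quat) : R -> R -> quat :=
  fun x y => f (slice_point I x y).

(* Coquelicot's total operator Derive is real-valued, hence is taken
   componentwise; this is the derivative as soon as ex_derive h t holds. *)
Definition QDerive (h : R -> quat) (t : R) : quat :=
  (Derive (fun s => qre (h s)) t, Derive (fun s => qim_i (h s)) t,
   Derive (fun s => qim_j (h s)) t, Derive (fun s => qim_k (h s)) t).

Definition dir_deriv (v : quat) (f : quat -> quat) (q : quat) : quat :=
  QDerive (fun t => f (q + scal t v)%H) 0.

(* f is of class C^k on R^4: f is C^(k+1) iff all its directional derivatives
   exist everywhere and are C^k. *)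
Fixpoint class_C (k : nat) (f : quat -> quat) : Prop :=
  match k with
  | O => forall q : quat, continuous f q
  | S k' => forall v : quat,
      (forall q : quat, ex_derive (fun t : R => f (q + scal t v)%H) 0) /\
      class_C k' (dir_deriv v f)
  end.

Definition partial_x (h : R -> R -> quat) : R -> R -> quat :=
  fun x y => QDerive (fun s => h s y) x.

Definition partial_y (h : R -> R -> quat) : R -> R -> quat :=
  fun x y => QDerive (fun s => h x s) y.

Definition dbar (I : quat) (h : R -> R -> quat) : R -> R -> quat :=
  fun x y => scal (1 / 2) (partial_x h x y + I * partial_y h x y)%H.

(* "Sufficiently real differentiable" is read as: of class C^(n+1) on the whole
   of R^4, not only along each slice. *)
Definition SR (n : nat) (f : quat -> quat) : Prop :=
  class_C (S n) f /\
  forall I : quat, in_S I ->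
  forall x y : R, Nat.iter (S n) (dbar I) (slice I f) x y = zero.

Definition slice_regular (f : quat -> quat) : Prop := SR 0 f.

Definition S_polyregular (f : quat -> quat) : Prop := exists n : nat, SR n f.

Definition right_polynomial (f : quat -> quat) : Prop :=
  exists (M : nat) (beta : nat -> quat),
  forall q : quat, f q = sum_n (fun l => (qpow q l * beta l)%H) M.

(* F is read as a function of x + I y in C_I: real differentiable together with
   the Cauchy-Riemann equation for the complex structure I. *)
Definition holomorphic_CI (I : quat) (F : R -> R -> quat) : Prop :=
  (forall x y : R, in_CI I (F x y)) /\
  (forall x y : R,
     ex_filterdiff (fun p : R * R => F (fst p) (snd p)) (locally (x, y))) /\
  (forall x y : R, dbar I F x y = zero).

Definition splitting (I J : quat) (phi : quat -> quat) (F G : R -> R -> quat)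
  : Prop :=
  holomorphic_CI I F /\ holomorphic_CI I G /\
  forall x y : R, slice I phi x y = (F x y + G x y * J)%H.

(* sum_n a m is the sum of a j over 0 <= j <= m *)
Definition polyreg_sum (m : nat) (phi : nat -> quat -> quat) (q : quat) : quat :=
  sum_n (fun j => (qpow (qconj q) j * phi j q)%H) m.

Definition odotLsp (m n : nat) (phi psi : nat -> quat -> quat) (q : quat)
  : quat :=
  sum_n (fun j =>
    sum_n (fun k => (qpow (qconj q) (j + k) * phi j q * psi k q)%H) n) m.

(* Main.v *)
(** A slice regular function [phi] is the sum [sum q^n A_n] of an everywhere
    convergent quaternionic power series, by Cauchy's formula on one slice
    paired with real functionals; hence it is smooth on R^4, and its derivative
    [phi'] along the real axis is again slice regular. On [C_I] let [G] be the
    part of [phi] anticommuting with [I]. Then [dbar (phi * psi) = G * psi'] and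
    [dbar (G * psi) = G * psi'], so [dbar^k (phi * psi) = G * psi^(k)]. Each of
    the three hypotheses makes [G * psi^(k)] vanish for some uniform [k], and
    multiplication by [qconj q ^ p] raises the order of polyholomorphy by at
    most [p]. *)
Require Import Defs.
From Stdlib Require Import Reals Lra Lia FunctionalExtensionality.
From Coquelicot Require Import Coquelicot.

(** * Taylor expansion of entire functions of one complex variable *)

(** A slice regular function is given only as C^1 on R^4, whereas [SR n] demands class C^(n+1) of
    the product in all directions, those transversal to the slices included. This gap is why a
    global power series is built: its terms are smooth on R^4, and uniform bounds carry smoothness
    to the sum. Cauchy's formula is obtained without contour integrals, by contracting the circle to
    z and differentiating a real integral in the contraction parameter. In dbar (phi * psi) the two
    terms with phi' cancel, and half of phi * psi' + I * phi * I * psi' remains, from which the part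
    of phi commuting with I drops out. Since G is its own anticommuting part, each further dbar
    differentiates psi only. *)

Lemma continuity_2d_pt_comp (f g h : R -> R -> R) (x y : R) :
  continuity_2d_pt f (g x y) (h x y) ->
  continuity_2d_pt g x y -> continuity_2d_pt h x y ->
  continuity_2d_pt (fun s t => f (g s t) (h s t)) x y.
Proof.
  rewrite !continuity_2d_pt_filterlim. intros Hf Hg Hh.
  apply (continuous_comp_2 (fun z : R * R => g (fst z) (snd z))
           (fun z : R * R => h (fst z) (snd z)) f (x, y)); assumption.
Qed.

Lemma continuity_2d_pt_slice (f : R -> R -> R) (x y : R) :
  continuity_2d_pt f x y -> continuous (f x) y.
Proof.
  rewrite continuity_2d_pt_filterlim. intros Hf.
  apply (continuous_comp_2 (fun _ : R => x) (fun t => t) f y).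
  - apply continuous_const.
  - apply continuous_id.
  - exact Hf.
Qed.

(** By uniform continuity with epsilon 1, f changes by less than 1 on each short step along the
    segment from the origin to (x, y), so the number of steps bounds the growth. *)
Lemma square_bound (f : R -> R -> R) (r : R) :
  (forall x y, continuity_2d_pt f x y) ->
  exists M, forall x y, Rabs x <= r -> Rabs y <= r -> Rabs (f x y) <= M.
Proof.
  intros Hf.
  destruct (uniform_continuity_2d f (- r) r (- r) r (fun x y _ _ => Hf x y)
              (mkposreal 1 Rlt_0_1)) as [d Hd].
  destruct (nfloor_ex (Rabs r / d)) as [n Hn].
  { apply Rdiv_le_0_compat; [apply Rabs_pos | apply cond_pos]. }
  (* N exceeds |r| / d, so N equal steps from the origin each move both coordinates by less than
     d. *)
  set (N := S n).
  assert (HN : 0 < INR N) by (unfold N; apply lt_0_INR; lia).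
  exists (Rabs (f 0 0) + INR N). intros x y Hx Hy.
  assert (Hstep : forall k, (k <= N)%nat ->
    Rabs (f (x * (INR k / INR N)) (y * (INR k / INR N))) <= Rabs (f 0 0) + INR k).
  { assert (Hsmall : forall z, Rabs z <= r -> forall k, (S k <= N)%nat ->
      Rabs (z * (INR (S k) / INR N) - z * (INR k / INR N)) < d).
    { intros z Hz k _. rewrite S_INR.
      replace (z * ((INR k + 1) / INR N) - z * (INR k / INR N)) with (z / INR N)
        by (field; lra).
      unfold Rdiv. rewrite Rabs_mult, Rabs_inv, (Rabs_pos_eq (INR N)) by lra.
      apply Rmult_lt_reg_r with (INR N); [exact HN|].
      rewrite Rmult_assoc, Rinv_l, Rmult_1_r by lra.
      assert (H0 : Rabs r < d * INR N).
      { unfold N. rewrite S_INR. destruct Hn as [_ Hn].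
        apply (Rmult_lt_compat_l d) in Hn; [|apply cond_pos].
        pose proof (cond_pos d).
        replace (d * (Rabs r / d)) with (Rabs r) in Hn by (field; lra).
        exact Hn. }
      pose proof (Rle_abs r). lra. }
    assert (Hin : forall z, Rabs z <= r -> forall k, (k <= N)%nat ->
      - r <= z * (INR k / INR N) <= r).
    { intros z Hz k Hk. apply Rabs_le_between.
      rewrite Rabs_mult.
      assert (0 <= INR k / INR N <= 1).
      { split; [apply Rdiv_le_0_compat; [apply pos_INR|exact HN]|].
        apply Rmult_le_reg_r with (INR N); [exact HN|].
        unfold Rdiv. rewrite Rmult_assoc, Rinv_l by lra.
        apply le_INR in Hk. lra. }
      rewrite (Rabs_pos_eq (INR k / INR N)) by lra.
      pose proof (Rabs_pos z). nra. }
    induction k as [|k IH]; intros Hk.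
    - simpl. unfold Rdiv. rewrite Rmult_0_l, !Rmult_0_r. lra.
    - specialize (IH ltac:(lia)).
      pose proof (Hd _ _ _ _ (Hin x Hx k ltac:(lia)) (Hin y Hy k ltac:(lia))
        (Hin x Hx (S k) Hk) (Hin y Hy (S k) Hk)
        (Hsmall x Hx k Hk) (Hsmall y Hy k Hk)) as H.
      simpl pos in H. rewrite (S_INR k) in H |- * .
      match type of H with Rabs (?p - ?q) < _ =>
        replace p with ((p - q) + q) by ring;
        pose proof (Rabs_triang (p - q) q) end.
      lra. }
  specialize (Hstep N (le_n _)).
  replace (INR N / INR N) with 1 in Hstep by (field; lra).
  rewrite !Rmult_1_r in Hstep. exact Hstep.
Qed.

(** The complex power (x + i y)^n as a pair of reals: all integrals stay real, and the same numbers
    serve on every slice C_I. *)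
Fixpoint cpow (x y : R) (n : nat) : R * R :=
  match n with
  | O => (1, 0)
  | S n' => (x * fst (cpow x y n') - y * snd (cpow x y n'),
             x * snd (cpow x y n') + y * fst (cpow x y n'))
  end.

Lemma cpow_norm (x y : R) (n : nat) :
  fst (cpow x y n) ^ 2 + snd (cpow x y n) ^ 2 = (x ^ 2 + y ^ 2) ^ n.
Proof.
  induction n as [|n IH]; [simpl; ring|].
  change ((x ^ 2 + y ^ 2) ^ S n) with ((x ^ 2 + y ^ 2) * (x ^ 2 + y ^ 2) ^ n).
  rewrite <- IH. simpl. ring.
Qed.

Lemma cpow_real (x : R) (n : nat) : cpow x 0 n = (x ^ n, 0).
Proof. induction n as [|n IH]; simpl; [reflexivity|]. rewrite IH. simpl. f_equal; ring. Qed.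

(* [kc] and [ks] are the real and imaginary parts of (z / zeta)^n, where
   z = x + i y and zeta = rho e^(i theta). *)
Definition kc (rho x y : R) (n : nat) (theta : R) : R :=
  / rho ^ n * (fst (cpow x y n) * cos (INR n * theta)
               + snd (cpow x y n) * sin (INR n * theta)).

Definition ks (rho x y : R) (n : nat) (theta : R) : R :=
  / rho ^ n * (snd (cpow x y n) * cos (INR n * theta)
               - fst (cpow x y n) * sin (INR n * theta)).

(** Real and imaginary parts of z w^n = zeta w^(n+1), where w = z / zeta. *)
Lemma kcks_step (rho x y : R) (n : nat) (theta : R) : 0 < rho ->
  x * kc rho x y n theta - y * ks rho x y n theta =
    rho * (cos theta * kc rho x y (S n) theta - sin theta * ks rho x y (S n) theta) /\
  x * ks rho x y n theta + y * kc rho x y n theta =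
    rho * (cos theta * ks rho x y (S n) theta + sin theta * kc rho x y (S n) theta).
Proof.
  intros Hr. unfold kc, ks.
  replace (INR (S n) * theta) with (INR n * theta + theta) by (rewrite S_INR; ring).
  rewrite cos_plus, sin_plus. simpl cpow. unfold fst, snd.
  destruct (cpow x y n) as [X Y].
  assert (Hp : rho ^ n <> 0) by (apply pow_nonzero; lra).
  simpl pow. rewrite Rinv_mult.
  pose proof (sin2_cos2 theta) as E. unfold Rsqr in E.
  set (c := cos (INR n * theta)). set (s := sin (INR n * theta)).
  split.
  (* The factor sin^2 + cos^2 = 1 is inserted so that the remaining identity is purely rational and
     falls to [field]. *)
  - transitivity (/ rho ^ n * ((x * X - y * Y) * c + (x * Y + y * X) * s)
      * (sin theta * sin theta + cos theta * cos theta)).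
    + rewrite E. ring.
    + field. split; lra.
  - transitivity (/ rho ^ n * ((x * Y + y * X) * c - (x * X - y * Y) * s)
      * (sin theta * sin theta + cos theta * cos theta)).
    + rewrite E. ring.
    + field. split; lra.
Qed.

(** The factor 2 only counts the two products in [kc] and [ks]; geometric decay in n is all that
    matters later. *)
Lemma kcks_bound (rho r x y : R) (n : nat) (theta : R) : 0 < rho -> 0 <= r ->
  x ^ 2 + y ^ 2 <= r ^ 2 ->
  Rabs (kc rho x y n theta) <= 2 * (r / rho) ^ n /\
  Rabs (ks rho x y n theta) <= 2 * (r / rho) ^ n.
Proof.
  intros Hr H0 Hz.
  assert (Hb : Rabs (fst (cpow x y n)) <= r ^ n /\ Rabs (snd (cpow x y n)) <= r ^ n).
  { pose proof (cpow_norm x y n) as E.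
    assert (E2 : (x ^ 2 + y ^ 2) ^ n <= (r ^ n) ^ 2).
    { rewrite <- pow_mult, Nat.mul_comm, pow_mult. apply pow_incr. nra. }
    assert (0 <= r ^ n) by (apply pow_le; lra).
    split; apply Rabs_le; split; nra. }
  destruct Hb as [HX HY].
  assert (Hq : 0 < / rho ^ n) by (apply Rinv_0_lt_compat, pow_lt; exact Hr).
  assert (Hprod : forall p q, Rabs p <= r ^ n -> -1 <= q <= 1 -> Rabs (p * q) <= r ^ n).
  { intros p q Hp Hq'. rewrite Rabs_mult.
    assert (Rabs q <= 1) by (apply Rabs_le; exact Hq').
    pose proof (Rabs_pos p). pose proof (Rabs_pos q). nra. }
  pose proof (COS_bound (INR n * theta)) as Hc.
  pose proof (SIN_bound (INR n * theta)) as Hs.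
  unfold Rdiv. rewrite Rpow_mult_distr, pow_inv.
  assert (Hgen : forall p q, Rabs p <= r ^ n -> Rabs q <= r ^ n ->
    Rabs (/ rho ^ n * (p + q)) <= 2 * (r ^ n * / rho ^ n)).
  { intros p q Hp Hq'. rewrite Rabs_mult, (Rabs_pos_eq (/ rho ^ n)) by lra.
    pose proof (Rabs_triang p q). nra. }
  unfold kc, ks, Rminus. split; apply Hgen; rewrite ?Rabs_Ropp; apply Hprod; assumption.
Qed.

(** [KC] + i [KS] is the partial sum of the geometric series of zeta / (zeta - z), that is, the
    Cauchy kernel with respect to d theta = d zeta / (i zeta). *)
Definition KC (rho x y : R) (N : nat) (theta : R) : R :=
  sum_n (fun n => kc rho x y n theta) N.

Definition KS (rho x y : R) (N : nat) (theta : R) : R :=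
  sum_n (fun n => ks rho x y n theta) N.

(* (zeta - z) * sum_(n <= N) w^n = zeta * (1 - w^(N+1)) with w = z / zeta. *)
Lemma kernel_telescope (rho x y : R) (N : nat) (theta : R) : 0 < rho ->
  (rho * cos theta - x) * KC rho x y N theta - (rho * sin theta - y) * KS rho x y N theta
    = rho * cos theta - (rho * (cos theta * kc rho x y (S N) theta
                                - sin theta * ks rho x y (S N) theta)) /\
  (rho * sin theta - y) * KC rho x y N theta + (rho * cos theta - x) * KS rho x y N theta
    = rho * sin theta - (rho * (cos theta * ks rho x y (S N) theta
                                + sin theta * kc rho x y (S N) theta)).
Proof.
  intros Hr. unfold KC, KS. induction N as [|N [IH1 IH2]].
  - rewrite !sum_O. destruct (kcks_step rho x y 0 theta Hr) as [<- <-].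
    unfold kc, ks. simpl. rewrite (Rmult_0_l theta), cos_0, sin_0. rewrite Rinv_1. split; ring.
  - rewrite !sum_Sn. unfold plus; simpl plus.
    destruct (kcks_step rho x y (S N) theta Hr) as [<- <-].
    split.
    + match type of IH1 with _ = ?r => transitivity
        (r + ((rho * cos theta - x) * kc rho x y (S N) theta
              - (rho * sin theta - y) * ks rho x y (S N) theta)) end.
      * rewrite <- IH1. simpl. ring.
      * simpl. ring.
    + match type of IH2 with _ = ?r => transitivity
        (r + ((rho * sin theta - y) * kc rho x y (S N) theta
              + (rho * cos theta - x) * ks rho x y (S N) theta)) end.
      * rewrite <- IH2. simpl. ring.
      * simpl. ring.
Qed.

(** * Circle integrals of the truncated Cauchy kernel *)

Lemma RInt_cos_multiple (n : nat) : is_RInt (fun t => cos (INR (S n) * t)) 0 (2 * PI) 0.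
Proof.
  assert (Hn : INR (S n) <> 0) by (apply not_0_INR; lia).
  replace 0 with (minus (sin (INR (S n) * (2 * PI)) / INR (S n)) (sin (INR (S n) * 0) / INR (S n))) at 2.
  - apply (is_RInt_derive (fun t => sin (INR (S n) * t) / INR (S n))).
    + intros t _. revert Hn. generalize (INR (S n)). intros c Hn.
      auto_derive; [trivial|]. field. exact Hn.
    + intros t _. apply (ex_derive_continuous (fun t => cos (INR (S n) * t))). auto_derive. trivial.
  - replace (INR (S n) * (2 * PI)) with (0 + 2 * INR (S n) * PI) by ring.
    rewrite sin_period, Rmult_0_r, sin_0. unfold minus, plus, opp; simpl. lra.
Qed.

Lemma RInt_sin_multiple (n : nat) : is_RInt (fun t => sin (INR (S n) * t)) 0 (2 * PI) 0.
Proof.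
  assert (Hn : INR (S n) <> 0) by (apply not_0_INR; lia).
  replace 0 with (minus (- cos (INR (S n) * (2 * PI)) / INR (S n)) (- cos (INR (S n) * 0) / INR (S n))) at 2.
  - apply (is_RInt_derive (fun t => - cos (INR (S n) * t) / INR (S n))).
    + intros t _. revert Hn. generalize (INR (S n)). intros c Hn.
      auto_derive; [trivial|]. field. exact Hn.
    + intros t _. apply (ex_derive_continuous (fun t => sin (INR (S n) * t))). auto_derive. trivial.
  - replace (INR (S n) * (2 * PI)) with (0 + 2 * INR (S n) * PI) by ring.
    rewrite cos_period, Rmult_0_r, cos_0. unfold minus, plus, opp; simpl. lra.
Qed.

Lemma is_RInt_kc (rho x y : R) (n : nat) : is_RInt (kc rho x y (S n)) 0 (2 * PI) 0.
Proof.
  unfold kc. set (X := fst _). set (Y := snd _). set (c := / rho ^ S n).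
  apply (is_RInt_ext (fun t => plus (scal (c * X) (cos (INR (S n) * t)))
                                    (scal (c * Y) (sin (INR (S n) * t))))).
  - intros t _. unfold plus, scal; simpl; unfold mult; simpl. ring.
  - replace 0 with (plus (scal (c * X) 0) (scal (c * Y) 0)) at 2.
    + apply @is_RInt_plus; apply @is_RInt_scal;
        [apply RInt_cos_multiple | apply RInt_sin_multiple].
    + unfold plus, scal; simpl; unfold mult; simpl. ring.
Qed.

Lemma is_RInt_ks (rho x y : R) (n : nat) : is_RInt (ks rho x y (S n)) 0 (2 * PI) 0.
Proof.
  unfold ks. set (X := fst _). set (Y := snd _). set (c := / rho ^ S n).
  apply (is_RInt_ext (fun t => plus (scal (c * Y) (cos (INR (S n) * t)))
                                    (scal (- (c * X)) (sin (INR (S n) * t))))).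
  - intros t _. unfold plus, scal; simpl; unfold mult; simpl. ring.
  - replace 0 with (plus (scal (c * Y) 0) (scal (- (c * X)) 0)) at 2.
    + apply @is_RInt_plus; apply @is_RInt_scal;
        [apply RInt_cos_multiple | apply RInt_sin_multiple].
    + unfold plus, scal; simpl; unfold mult; simpl. ring.
Qed.

(** Only the constant term n = 0 survives integration over a full period. *)
Lemma is_RInt_KC (rho x y : R) (N : nat) : is_RInt (KC rho x y N) 0 (2 * PI) (2 * PI).
Proof.
  unfold KC. induction N as [|N IH].
  - apply (is_RInt_ext (fun _ => 1)).
    + intros t _. rewrite sum_O. unfold kc. simpl. rewrite (Rmult_0_l t), cos_0. field.
    + replace (2 * PI) with (scal (2 * PI - 0) 1) at 2.
      * apply @is_RInt_const.
      * unfold scal; simpl; unfold mult; simpl. ring.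
  - apply (is_RInt_ext (fun t => plus (sum_n (fun n => kc rho x y n t) N) (kc rho x y (S N) t))).
    + intros t _. rewrite sum_Sn. reflexivity.
    + replace (2 * PI) with (plus (2 * PI) 0) at 2 by apply Rplus_0_r.
      apply @is_RInt_plus; [exact IH | apply is_RInt_kc].
Qed.

Lemma is_RInt_KS (rho x y : R) (N : nat) : is_RInt (KS rho x y N) 0 (2 * PI) 0.
Proof.
  unfold KS. induction N as [|N IH].
  - apply (is_RInt_ext (fun _ => 0)).
    + intros t _. rewrite sum_O. unfold ks. simpl. rewrite (Rmult_0_l t), sin_0. field.
    + pose proof (@is_RInt_const R_NormedModule 0 (2 * PI) 0) as H.
      change (is_RInt (fun _ : R => 0) 0 (2 * PI) ((2 * PI - 0) * 0)) in H.
      rewrite Rmult_0_r in H. exact H.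
  - apply (is_RInt_ext (fun t => plus (sum_n (fun n => ks rho x y n t) N) (ks rho x y (S N) t))).
    + intros t _. rewrite sum_Sn. reflexivity.
    + replace 0 with (plus 0 0) at 2 by apply Rplus_0_r.
      apply @is_RInt_plus; [exact IH | apply is_RInt_ks].
Qed.

(* The Cauchy-Riemann system for u + i v, where a + i b is the complex derivative. *)
Definition cauchy_riemann (u v a b : R -> R -> R) : Prop :=
  (forall x y, differentiable_pt_lim u x y (a x y) (- b x y)) /\
  (forall x y, differentiable_pt_lim v x y (b x y) (a x y)) /\
  (forall x y, continuity_2d_pt a x y) /\ (forall x y, continuity_2d_pt b x y).

(** Since - i (u + i v) = v - i u, any result on real parts also covers imaginary parts. *)
Lemma cauchy_riemann_mult_minus_i (u v a b : R -> R -> R) :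
  cauchy_riemann u v a b ->
  cauchy_riemann v (fun x y => - u x y) b (fun x y => - a x y).
Proof.
  intros (Hu & Hv & Ha & Hb). split; [|split; [|split]].
  - intros x y. rewrite Ropp_involutive. apply Hv.
  - intros x y. apply filterdiff_differentiable_pt_lim.
    specialize (Hu x y). apply filterdiff_differentiable_pt_lim in Hu.
    apply filterdiff_opp_fct in Hu.
    eapply filterdiff_ext_lin; [exact Hu|].
    intros [s t]. unfold opp; simpl. ring.
  - exact Hb.
  - intros x y. apply continuity_2d_pt_opp, Ha.
Qed.

Lemma cauchy_riemann_continuous (u v a b : R -> R -> R) (x y : R) :
  cauchy_riemann u v a b -> continuity_2d_pt u x y.
Proof.
  intros (Hu & _). apply differentiable_continuity_pt. eexists. eexists. apply Hu.
Qed.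

(** One coordinate of z + t (zeta - z): p is that coordinate of z, and [trig] is [cos] or [sin]. *)
Definition homotopy (rho p : R) (trig : R -> R) (t theta : R) : R :=
  p + t * (rho * trig theta - p).

Lemma continuity_2d_pt_theta (f : R -> R) (t theta : R) :
  continuous f theta -> continuity_2d_pt (fun _ s => f s) t theta.
Proof.
  intros Hf. apply (continuity_1d_2d_pt_comp f (fun _ s => s)).
  - apply continuity_pt_filterlim. exact Hf.
  - apply continuity_2d_pt_id2.
Qed.

Lemma continuity_2d_pt_homotopy (rho p : R) (trig : R -> R) (t theta : R) :
  continuous trig theta -> continuity_2d_pt (homotopy rho p trig) t theta.
Proof.
  intros Hf. unfold homotopy.
  apply continuity_2d_pt_plus; [apply continuity_2d_pt_const|].
  apply continuity_2d_pt_mult; [apply continuity_2d_pt_id1|].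
  apply continuity_2d_pt_minus; [|apply continuity_2d_pt_const].
  apply continuity_2d_pt_mult; [apply continuity_2d_pt_const|].
  apply continuity_2d_pt_theta, Hf.
Qed.

(** Convexity keeps the contraction inside the square on which the derivative is bounded. *)
Lemma homotopy_bound (rho p : R) (trig : R -> R) (t theta : R) :
  0 <= t <= 1 -> Rabs p <= rho -> -1 <= trig theta <= 1 ->
  Rabs (homotopy rho p trig t theta) <= rho.
Proof.
  intros Ht Hp Hc. unfold homotopy. apply Rabs_le. apply Rabs_le_between in Hp.
  assert (- rho <= rho * trig theta <= rho) by nra. nra.
Qed.

Lemma continuous_kc (rho x y : R) (n : nat) (theta : R) : continuous (kc rho x y n) theta.
Proof.
  apply (ex_derive_continuous (kc rho x y n)). unfold kc.
  generalize (INR n) (fst (cpow x y n)) (snd (cpow x y n)) (/ rho ^ n). intros.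
  auto_derive. trivial.
Qed.

Lemma continuous_ks (rho x y : R) (n : nat) (theta : R) : continuous (ks rho x y n) theta.
Proof.
  apply (ex_derive_continuous (ks rho x y n)). unfold ks.
  generalize (INR n) (fst (cpow x y n)) (snd (cpow x y n)) (/ rho ^ n). intros.
  auto_derive. trivial.
Qed.

Lemma continuous_sum_n (f : nat -> R -> R) (N : nat) (t : R) :
  (forall n, continuous (f n) t) -> continuous (fun s => sum_n (fun n => f n s) N) t.
Proof.
  intros Hf. induction N as [|N IH].
  - apply (continuous_ext (f O)); [intros s; rewrite sum_O; reflexivity | apply Hf].
  - apply (continuous_ext (fun s => plus (sum_n (fun n => f n s) N) (f (S N) s))).
    + intros s. rewrite sum_Sn. reflexivity.
    + apply @continuous_plus; [exact IH | apply Hf].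
Qed.

(* The derivative of [t |-> u (z + t (zeta - z)) KC - v (z + t (zeta - z)) KS]
   telescopes; its leading term is a theta-derivative divided by t, so only the
   geometrically small tail survives integration over the circle. *)
Lemma cauchy_remainder (u v a b : R -> R -> R) (rho r x y M : R) (N : nat) :
  cauchy_riemann u v a b -> 0 < rho -> 0 <= r <= rho -> x ^ 2 + y ^ 2 <= r ^ 2 ->
  0 <= M ->
  (forall s t, Rabs s <= rho -> Rabs t <= rho -> Rabs (a s t) <= M) ->
  (forall s t, Rabs s <= rho -> Rabs t <= rho -> Rabs (b s t) <= M) ->
  Rabs (RInt (fun t => u (rho * cos t) (rho * sin t) * KC rho x y N t
                       - v (rho * cos t) (rho * sin t) * KS rho x y N t) 0 (2 * PI)
        - 2 * PI * u x y)
  <= 2 * PI * (8 * M * rho * (r / rho) ^ S N).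
Proof.
  intros HCR Hrho Hr Hz HM Ma Mb.
  assert (Cu : forall x y, continuity_2d_pt u x y)
    by (intros; eapply cauchy_riemann_continuous; exact HCR).
  assert (Cv : forall x y, continuity_2d_pt v x y)
    by (intros; eapply cauchy_riemann_continuous, cauchy_riemann_mult_minus_i; exact HCR).
  destruct HCR as (Hu & Hv & Ca & Cb).
  set (P := homotopy rho x cos). set (Q := homotopy rho y sin).
  (* [Er] + i [Ei] = zeta w^(N+1), the remainder of the telescoped kernel; hence [dPhi] is the real
     part of f' (zeta - zeta w^(N+1)). *)
  set (Er := fun th => rho * (cos th * kc rho x y (S N) th - sin th * ks rho x y (S N) th)).
  set (Ei := fun th => rho * (cos th * ks rho x y (S N) th + sin th * kc rho x y (S N) th)).
  set (Phi := fun t th => u (P t th) (Q t th) * KC rho x y N th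
                          - v (P t th) (Q t th) * KS rho x y N th).
  set (dPhi := fun t th => a (P t th) (Q t th) * (rho * cos th - Er th)
                           - b (P t th) (Q t th) * (rho * sin th - Ei th)).
  assert (CPQ : forall f : R -> R -> R, (forall x y, continuity_2d_pt f x y) ->
    forall t th, continuity_2d_pt (fun t th => f (P t th) (Q t th)) t th).
  { intros f Hf t th. apply continuity_2d_pt_comp; [apply Hf| |];
      apply continuity_2d_pt_homotopy; [apply continuous_cos|apply continuous_sin]. }
  assert (CKC : forall th, continuous (KC rho x y N) th)
    by (intros th; apply (continuous_sum_n (kc rho x y)); intros; apply continuous_kc).
  assert (CKS : forall th, continuous (KS rho x y N) th)
    by (intros th; apply (continuous_sum_n (ks rho x y)); intros; apply continuous_ks).
  assert (CPhi : forall t th, continuity_2d_pt Phi t th).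
  { intros t th. apply continuity_2d_pt_minus; apply continuity_2d_pt_mult;
      (apply CPQ || apply continuity_2d_pt_theta); auto. }
  assert (CE : forall t th, continuity_2d_pt (fun _ th => Er th) t th /\
                            continuity_2d_pt (fun _ th => Ei th) t th).
  { intros t th. unfold Er, Ei. split.
    - apply continuity_2d_pt_mult; [apply continuity_2d_pt_const|].
      apply continuity_2d_pt_minus; apply continuity_2d_pt_mult;
        apply continuity_2d_pt_theta;
        auto using continuous_sin, continuous_cos, continuous_kc, continuous_ks.
    - apply continuity_2d_pt_mult; [apply continuity_2d_pt_const|].
      apply continuity_2d_pt_plus; apply continuity_2d_pt_mult;
        apply continuity_2d_pt_theta;
        auto using continuous_sin, continuous_cos, continuous_kc, continuous_ks. }
  assert (CdPhi : forall t th, continuity_2d_pt dPhi t th).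
  { intros t th. apply continuity_2d_pt_minus; apply continuity_2d_pt_mult;
      try (apply CPQ; assumption);
      (apply continuity_2d_pt_minus; [|apply CE]);
      (apply continuity_2d_pt_mult; [apply continuity_2d_pt_const|]);
      apply continuity_2d_pt_theta; auto using continuous_sin, continuous_cos. }
  assert (DP : forall t th, derivable_pt_lim (fun t => P t th) t (rho * cos th - x)).
  { intros t th. apply is_derive_Reals. unfold P, homotopy. auto_derive; [trivial|ring]. }
  assert (DQ : forall t th, derivable_pt_lim (fun t => Q t th) t (rho * sin th - y)).
  { intros t th. apply is_derive_Reals. unfold Q, homotopy. auto_derive; [trivial|ring]. }
  assert (DPhi : forall t th, is_derive (fun t => Phi t th) t (dPhi t th)).
  { intros t th.
    pose proof (derivable_pt_lim_comp_2d _ _ _ _ _ _ _ _ (Hu _ _) (DP t th) (DQ t th)) as Du.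
    pose proof (derivable_pt_lim_comp_2d _ _ _ _ _ _ _ _ (Hv _ _) (DP t th) (DQ t th)) as Dv.
    apply is_derive_Reals in Du, Dv.
    pose proof (is_derive_minus _ _ t _ _
      (is_derive_scal_l _ t _ (KC rho x y N th) Du)
      (is_derive_scal_l _ t _ (KS rho x y N th) Dv)) as D.
    eapply is_derive_ext in D.
    - match type of D with is_derive _ _ ?l => replace (dPhi t th) with l; [exact D|] end.
      unfold minus, plus, opp, scal; simpl; unfold mult; simpl. unfold dPhi.
      destruct (kernel_telescope rho x y N th Hrho) as [T1 T2].
      fold (Er th) in T1. fold (Ei th) in T2. rewrite <- T1, <- T2. ring.
    - intros s. reflexivity. }
  set (phi := fun t => RInt (Phi t) 0 (2 * PI)).
  assert (HPI : 0 < 2 * PI) by (pose proof PI_RGT_0; lra).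
  assert (Dphi : forall t, is_derive phi t (RInt (dPhi t) 0 (2 * PI))).
  { intros t.
    replace (RInt (dPhi t) 0 (2 * PI))
      with (RInt (fun th => Derive (fun s => Phi s th) t) 0 (2 * PI))
      by (apply RInt_ext; intros; apply is_derive_unique, DPhi).
    apply (is_derive_RInt_param Phi).
    - apply filter_forall. intros s th _. eexists. apply DPhi.
    - intros th _. apply continuity_2d_pt_ext with dPhi; [|apply CdPhi].
      intros. symmetry. apply is_derive_unique, DPhi.
    - apply filter_forall. intros s. apply (@ex_RInt_continuous R_CompleteNormedModule).
      intros th _. apply continuity_2d_pt_slice, CPhi. }
  assert (Bound : forall t, 0 < t < 1 ->
    Rabs (RInt (dPhi t) 0 (2 * PI)) <= (2 * PI - 0) * (8 * M * rho * (r / rho) ^ S N)).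
  { intros t Ht.
    set (tail := fun th => a (P t th) (Q t th) * Er th - b (P t th) (Q t th) * Ei th).
    assert (Itail : ex_RInt tail 0 (2 * PI)).
    { apply (@ex_RInt_continuous R_CompleteNormedModule). intros th _.
      apply (continuity_2d_pt_slice (fun s th => a (P s th) (Q s th) * Er th
                                               - b (P s th) (Q s th) * Ei th)).
      apply continuity_2d_pt_minus; apply continuity_2d_pt_mult;
        try (apply CPQ; assumption); apply CE. }
    assert (Hzero : is_RInt (fun th => plus (dPhi t th) (tail th)) 0 (2 * PI) 0).
    (* Along the contracted circle d f / d theta = i t zeta f', so Re (zeta f') is the
       theta-derivative of v / t, which takes equal values at 0 and 2 pi. *)
    { set (V := fun th => v (P t th) (Q t th) / t).
      replace 0 with (minus (V (2 * PI)) (V 0)) at 2.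
      - apply (is_RInt_derive V).
        + intros th _.
          assert (DPt : derivable_pt_lim (fun th => P t th) th (- (t * rho * sin th))).
          { apply is_derive_Reals. unfold P, homotopy. auto_derive; [trivial|ring]. }
          assert (DQt : derivable_pt_lim (fun th => Q t th) th (t * rho * cos th)).
          { apply is_derive_Reals. unfold Q, homotopy. auto_derive; [trivial|ring]. }
          pose proof (derivable_pt_lim_comp_2d _ _ _ _ _ _ _ _ (Hv _ _) DPt DQt) as D.
          apply is_derive_Reals in D.
          pose proof (is_derive_scal_l _ th _ (/ t) D) as D'.
          match type of D' with is_derive _ _ ?l =>
            replace (plus (dPhi t th) (tail th)) with l; [exact D'|] end.
          unfold plus, scal; simpl; unfold mult; simpl. unfold dPhi, tail. field. lra.
        + intros th _.
          apply (@continuous_plus R_UniformSpace R_AbsRing R_NormedModule (dPhi t) tail).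
          * apply continuity_2d_pt_slice, CdPhi.
          * apply (continuity_2d_pt_slice (fun s th => a (P s th) (Q s th) * Er th
                                               - b (P s th) (Q s th) * Ei th)).
            apply continuity_2d_pt_minus; apply continuity_2d_pt_mult;
              try (apply CPQ; assumption); apply CE.
      - unfold V, P, Q, homotopy. rewrite cos_2PI, sin_2PI, cos_0, sin_0.
        apply Rplus_opp_r. }
    assert (IdPhi : ex_RInt (dPhi t) 0 (2 * PI)).
    { apply (@ex_RInt_continuous R_CompleteNormedModule). intros th _.
      apply continuity_2d_pt_slice, CdPhi. }
    pose proof (RInt_plus (dPhi t) tail 0 (2 * PI) IdPhi Itail) as E.
    assert (E0 : RInt (dPhi t) 0 (2 * PI) + RInt tail 0 (2 * PI) = 0).
    { etransitivity; [symmetry; exact E | apply is_RInt_unique; exact Hzero]. }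
    replace (RInt (dPhi t) 0 (2 * PI)) with (- RInt tail 0 (2 * PI)) by lra.
    rewrite Rabs_Ropp. apply abs_RInt_le_const; [lra | exact Itail |].
    intros th _. unfold tail.
    assert (HP : Rabs (P t th) <= rho).
    { apply homotopy_bound; [lra| |apply COS_bound]. apply Rabs_le. nra. }
    assert (HQ : Rabs (Q t th) <= rho).
    { apply homotopy_bound; [lra| |apply SIN_bound]. apply Rabs_le. nra. }
    specialize (Ma _ _ HP HQ). specialize (Mb _ _ HP HQ).
    destruct (kcks_bound rho r x y (S N) th Hrho (proj1 Hr) Hz) as [B1 B2].
    set (q := (r / rho) ^ S N) in *.
    assert (Hq : 0 <= q) by (apply pow_le, Rdiv_le_0_compat; lra).
    assert (Habs : forall p q', -1 <= p <= 1 -> Rabs q' <= 2 * q -> Rabs (p * q') <= 2 * q).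
    { intros p q' Hp Hq'. rewrite Rabs_mult.
      assert (Rabs p <= 1) by (apply Rabs_le; lra).
      pose proof (Rabs_pos p). pose proof (Rabs_pos q'). nra. }
    pose proof (COS_bound th) as Hc. pose proof (SIN_bound th) as Hs.
    assert (HEr : Rabs (Er th) <= rho * (4 * q)).
    { unfold Er. rewrite Rabs_mult, (Rabs_pos_eq rho) by lra.
      apply Rmult_le_compat_l; [lra|]. unfold Rminus.
      eapply Rle_trans; [apply Rabs_triang|]. rewrite Rabs_Ropp.
      pose proof (Habs _ _ Hc B1). pose proof (Habs _ _ Hs B2). lra. }
    assert (HEi : Rabs (Ei th) <= rho * (4 * q)).
    { unfold Ei. rewrite Rabs_mult, (Rabs_pos_eq rho) by lra.
      apply Rmult_le_compat_l; [lra|].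
      eapply Rle_trans; [apply Rabs_triang|].
      pose proof (Habs _ _ Hc B2). pose proof (Habs _ _ Hs B1). lra. }
    unfold Rminus. eapply Rle_trans; [apply Rabs_triang|].
    rewrite Rabs_Ropp, !Rabs_mult.
    (* The 8 arises from two products, each at most M times the bound 4 rho q on [Er] or [Ei]. *)
    replace (8 * M * rho * q) with (M * (rho * (4 * q)) + M * (rho * (4 * q))) by ring.
    apply Rplus_le_compat; apply Rmult_le_compat; auto using Rabs_pos. }
  (* The intermediate point lies strictly inside (0, 1), so the division by t in [V] is legitimate
     there. *)
  destruct (MVT_cor2 phi (fun t => RInt (dPhi t) 0 (2 * PI)) 0 1 Rlt_0_1) as (c & Hc & Hc01).
  { intros c _. apply is_derive_Reals, Dphi. }
  assert (E1 : phi 1 = RInt (fun t => u (rho * cos t) (rho * sin t) * KC rho x y N t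
                       - v (rho * cos t) (rho * sin t) * KS rho x y N t) 0 (2 * PI)).
  { apply RInt_ext. intros th _. unfold Phi, P, Q, homotopy.
    replace (x + 1 * (rho * cos th - x)) with (rho * cos th) by ring.
    replace (y + 1 * (rho * sin th - y)) with (rho * sin th) by ring. reflexivity. }
  (* At t = 0 the factors u and v are constant in theta, and the kernel integrates to 2 pi in its
     real part and 0 in its imaginary part. *)
  assert (E0 : phi 0 = 2 * PI * u x y).
  { apply is_RInt_unique.
    apply (is_RInt_ext (fun th => plus (scal (u x y) (KC rho x y N th))
                                       (scal (- v x y) (KS rho x y N th)))).
    - intros th _. unfold Phi, P, Q, homotopy. rewrite !Rmult_0_l, !Rplus_0_r.
      unfold plus, scal; simpl; unfold mult; simpl. ring.
    - replace (2 * PI * u x y) with (plus (scal (u x y) (2 * PI)) (scal (- v x y) 0)).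
      + apply @is_RInt_plus; apply @is_RInt_scal; [apply is_RInt_KC | apply is_RInt_KS].
      + unfold plus, scal; simpl; unfold mult; simpl. ring. }
  rewrite <- E1, <- E0, Hc. rewrite Rminus_0_r, Rmult_1_r.
  eapply Rle_trans; [apply Bound; exact Hc01|]. rewrite Rminus_0_r. apply Rle_refl.
Qed.

(** * Taylor coefficients as circle integrals *)

(** The real part of c_n, the mean over the circle of (u + i v) zeta^(-n). Feeding it the pair (v, -
    u) yields the real part of - i c_n, that is, the imaginary part of c_n. *)
Definition coef (rho : R) (u v : R -> R -> R) (n : nat) : R :=
  / (2 * PI) * RInt (fun t => / rho ^ n *
    (u (rho * cos t) (rho * sin t) * cos (INR n * t)
     + v (rho * cos t) (rho * sin t) * sin (INR n * t))) 0 (2 * PI).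

Lemma continuous_circle (u : R -> R -> R) (rho t : R) :
  (forall x y, continuity_2d_pt u x y) ->
  continuous (fun t => u (rho * cos t) (rho * sin t)) t.
Proof.
  intros Hu.
  apply (continuity_2d_pt_slice (fun _ t => u (rho * cos t) (rho * sin t)) 0 t).
  apply continuity_2d_pt_comp; [apply Hu| |];
    (apply continuity_2d_pt_mult; [apply continuity_2d_pt_const|]);
    apply continuity_2d_pt_theta; auto using continuous_cos, continuous_sin.
Qed.

Lemma ex_RInt_coef (u v : R -> R -> R) (rho : R) (n : nat) :
  (forall x y, continuity_2d_pt u x y) -> (forall x y, continuity_2d_pt v x y) ->
  ex_RInt (fun t => / rho ^ n *
    (u (rho * cos t) (rho * sin t) * cos (INR n * t)
     + v (rho * cos t) (rho * sin t) * sin (INR n * t))) 0 (2 * PI).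
Proof.
  intros Hu Hv. apply (@ex_RInt_continuous R_CompleteNormedModule). intros t _.
  apply (continuous_scal_r (/ rho ^ n)
    (fun t => u (rho * cos t) (rho * sin t) * cos (INR n * t)
     + v (rho * cos t) (rho * sin t) * sin (INR n * t))).
  apply @continuous_plus; apply @continuous_mult; try (apply continuous_circle; assumption).
  - apply (ex_derive_continuous (fun t => cos (INR n * t))).
    generalize (INR n). intros. auto_derive. trivial.
  - apply (ex_derive_continuous (fun t => sin (INR n * t))).
    generalize (INR n). intros. auto_derive. trivial.
Qed.

Lemma coef_bound (u v : R -> R -> R) (rho : R) : 0 < rho ->
  (forall x y, continuity_2d_pt u x y) -> (forall x y, continuity_2d_pt v x y) ->
  exists C, forall n, Rabs (coef rho u v n) <= C / rho ^ n.
Proof.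
  intros Hrho Hu Hv.
  destruct (square_bound u rho Hu) as [M HM]. destruct (square_bound v rho Hv) as [M' HM'].
  exists (M + M'). intros n.
  assert (HPI : 0 < 2 * PI) by (pose proof PI_RGT_0; lra).
  unfold coef. rewrite Rabs_mult, Rabs_inv, (Rabs_pos_eq (2 * PI)) by lra.
  apply Rmult_le_reg_l with (2 * PI); [exact HPI|].
  rewrite <- Rmult_assoc, Rinv_r, Rmult_1_l by lra.
  replace (2 * PI * ((M + M') / rho ^ n)) with ((2 * PI - 0) * ((M + M') / rho ^ n)) by ring.
  apply abs_RInt_le_const; [lra | apply ex_RInt_coef; assumption|].
  intros t _.
  assert (Hp : 0 < / rho ^ n) by (apply Rinv_0_lt_compat, pow_lt; exact Hrho).
  rewrite Rabs_mult, (Rabs_pos_eq (/ rho ^ n)) by lra.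
  unfold Rdiv. rewrite (Rmult_comm (M + M')). apply Rmult_le_compat_l; [lra|].
  assert (Hc : Rabs (rho * cos t) <= rho).
  { pose proof (COS_bound t). apply Rabs_le. nra. }
  assert (Hs : Rabs (rho * sin t) <= rho).
  { pose proof (SIN_bound t). apply Rabs_le. nra. }
  specialize (HM _ _ Hc Hs). specialize (HM' _ _ Hc Hs).
  assert (Hcn : Rabs (cos (INR n * t)) <= 1) by (apply Rabs_le, COS_bound).
  assert (Hsn : Rabs (sin (INR n * t)) <= 1) by (apply Rabs_le, SIN_bound).
  eapply Rle_trans; [apply Rabs_triang|]. rewrite !Rabs_mult.
  apply Rplus_le_compat; rewrite <- Rmult_1_r; apply Rmult_le_compat;
    auto using Rabs_pos.
Qed.

(** Summand n is the real part of z^n c_n. *)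
Lemma is_RInt_cauchy_partial (u v : R -> R -> R) (rho x y : R) (N : nat) :
  (forall x y, continuity_2d_pt u x y) -> (forall x y, continuity_2d_pt v x y) ->
  is_RInt (fun t => u (rho * cos t) (rho * sin t) * KC rho x y N t
                    - v (rho * cos t) (rho * sin t) * KS rho x y N t) 0 (2 * PI)
    (2 * PI * sum_n (fun n => fst (cpow x y n) * coef rho u v n
       - snd (cpow x y n) * coef rho v (fun x y => - u x y) n) N).
Proof.
  intros Hu Hv.
  assert (Hu' : forall x y, continuity_2d_pt (fun x y => - u x y) x y)
    by (intros; apply continuity_2d_pt_opp, Hu).
  assert (HPI : 2 * PI <> 0) by (pose proof PI_RGT_0; lra).
  assert (Hone : forall n, is_RInt
    (fun t => u (rho * cos t) (rho * sin t) * kc rho x y n t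
              - v (rho * cos t) (rho * sin t) * ks rho x y n t) 0 (2 * PI)
    (2 * PI * (fst (cpow x y n) * coef rho u v n
       - snd (cpow x y n) * coef rho v (fun x y => - u x y) n))).
  { intros n.
    pose proof (RInt_correct _ _ _ (ex_RInt_coef u v rho n Hu Hv)) as I1.
    pose proof (RInt_correct _ _ _ (ex_RInt_coef v _ rho n Hv Hu')) as I2.
    pose proof (is_RInt_plus _ _ _ _ _ _
      (is_RInt_scal _ _ _ (fst (cpow x y n)) _ I1)
      (is_RInt_scal _ _ _ (- snd (cpow x y n)) _ I2)) as I.
    match type of I with is_RInt _ _ _ ?l =>
      replace (2 * PI * _) with l end.
    - eapply is_RInt_ext; [|exact I]. intros t _. cbv beta.
      unfold plus, scal; simpl; unfold mult; simpl. unfold kc, ks. ring.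
    - unfold plus, scal; simpl; unfold mult; simpl. unfold coef. field. lra. }
  unfold KC, KS. induction N as [|N IH].
  - rewrite sum_O. eapply is_RInt_ext; [|apply (Hone O)].
    intros t _. rewrite !sum_O. reflexivity.
  - rewrite sum_Sn.
    pose proof (is_RInt_plus _ _ _ _ _ _ IH (Hone (S N))) as I.
    match type of I with is_RInt _ _ _ ?l => replace (2 * PI * _) with l end.
    + eapply is_RInt_ext; [|exact I]. intros t _. cbv beta. rewrite !sum_Sn.
      unfold plus; simpl. ring.
    + unfold plus; simpl. ring.
Qed.

Lemma cauchy_taylor (u v a b : R -> R -> R) (rho x y : R) :
  cauchy_riemann u v a b -> 0 < rho -> x ^ 2 + y ^ 2 < rho ^ 2 ->
  is_series (fun n => fst (cpow x y n) * coef rho u v n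
     - snd (cpow x y n) * coef rho v (fun x y => - u x y) n) (u x y).
Proof.
  intros HCR Hrho Hz.
  assert (Cu : forall x y, continuity_2d_pt u x y)
    by (intros; eapply cauchy_riemann_continuous; exact HCR).
  assert (Cv : forall x y, continuity_2d_pt v x y)
    by (intros; eapply cauchy_riemann_continuous, cauchy_riemann_mult_minus_i; exact HCR).
  destruct (square_bound a rho) as [Ma HMa]; [apply HCR|].
  destruct (square_bound b rho) as [Mb HMb]; [apply HCR|].
  (* r = |z| < rho gives the remainder the ratio r / rho < 1. *)
  set (r := sqrt (x ^ 2 + y ^ 2)).
  assert (Hz0 : 0 <= x ^ 2 + y ^ 2) by nra.
  assert (Hr2 : r ^ 2 = x ^ 2 + y ^ 2).
  { apply pow2_sqrt, Hz0. }
  assert (Hr0 : 0 <= r) by apply sqrt_pos.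
  assert (Hr : r < rho) by nra.
  set (M := Rmax 0 (Rmax Ma Mb)).
  assert (HM : 0 <= M /\ Ma <= M /\ Mb <= M).
  { unfold M. pose proof (Rmax_l 0 (Rmax Ma Mb)). pose proof (Rmax_r 0 (Rmax Ma Mb)).
    pose proof (Rmax_l Ma Mb). pose proof (Rmax_r Ma Mb). lra. }
  destruct HM as (HM0 & HM1 & HM2).
  set (S' := sum_n (fun n => fst (cpow x y n) * coef rho u v n
     - snd (cpow x y n) * coef rho v (fun x y => - u x y) n)).
  assert (Hb : forall N, Rabs (S' N - u x y) <= 8 * M * rho * (r / rho) ^ S N).
  { intros N.
    assert (HPI : 0 < 2 * PI) by (pose proof PI_RGT_0; lra).
    apply Rmult_le_reg_l with (2 * PI); [exact HPI|].
    rewrite <- (Rabs_pos_eq (2 * PI)) at 1 by lra. rewrite <- Rabs_mult.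
    pose proof (cauchy_remainder u v a b rho r x y M N HCR Hrho ltac:(lra) ltac:(lra) HM0
      (fun s t Hs Ht => Rle_trans _ _ _ (HMa s t Hs Ht) HM1)
      (fun s t Hs Ht => Rle_trans _ _ _ (HMb s t Hs Ht) HM2)) as H.
    rewrite (is_RInt_unique _ _ _ _ (is_RInt_cauchy_partial u v rho x y N Cu Cv)) in H.
    fold (S' N) in H. rewrite <- Rmult_minus_distr_l in H. exact H. }
  assert (Hq : Rabs (r / rho) < 1).
  { rewrite Rabs_pos_eq by (apply Rdiv_le_0_compat; lra).
    apply Rmult_lt_reg_r with rho; [lra|]. unfold Rdiv. rewrite Rmult_assoc, Rinv_l; lra. }
  pose proof (is_lim_seq_geom _ Hq) as Hg. apply is_lim_seq_incr_1 in Hg.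
  apply (is_lim_seq_scal_l _ (8 * M * rho)) in Hg.
  change (is_lim_seq S' (u x y)).
  replace (Finite (u x y)) with (Finite (u x y + 0)) by (f_equal; ring).
  apply (is_lim_seq_ext (fun N => u x y + (S' N - u x y))); [intros; ring|].
  apply is_lim_seq_plus'; [apply is_lim_seq_const|].
  apply is_lim_seq_abs_0.
  apply (is_lim_seq_le_le (fun _ => 0) _ (fun N => 8 * M * rho * (r / rho) ^ S N)).
  - intros N. split; [apply Rabs_pos | apply Hb].
  - apply is_lim_seq_const.
  - replace (Finite 0) with (Rbar_mult (8 * M * rho) 0); [exact Hg|].
    simpl. f_equal. ring.
Qed.

(** * Quaternions and their real functionals *)

(** [quat] is three nested products, and the operations of an inner factor surface only after the
    outer ones are unfolded, hence the repeated rounds. *)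
Ltac quat_unfold :=
  repeat match goal with q : quat |- _ => destruct q as [[[? ?] ?] ?] end;
  unfold slice_point, qmul, qconj, qdot, qreal, qre, qim_i, qim_j, qim_k; simpl;
  unfold plus, opp, scal, zero; simpl;
  unfold prod_plus, prod_opp, prod_scal, prod_zero; simpl;
  unfold plus, opp, scal, zero; simpl;
  unfold prod_plus, prod_opp, prod_scal, prod_zero; simpl;
  unfold plus, opp, scal, zero; simpl;
  unfold prod_plus, prod_opp, prod_scal, prod_zero; simpl;
  unfold plus, opp, scal, zero; simpl; unfold mult; simpl.

Ltac quat_ring := intros; quat_unfold; repeat apply (f_equal2 pair); ring.

Local Open Scope quat_scope.

Notation quat_NM := (prod_NormedModule R_AbsRing
  (prod_NormedModule R_AbsRing
    (prod_NormedModule R_AbsRing R_NormedModule R_NormedModule) R_NormedModule)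
  R_NormedModule).

Lemma qmul_assoc (p q r : quat) : p * (q * r) = p * q * r.
Proof. quat_ring. Qed.

Lemma qmul_plus_l (p q r : quat) : (p + q) * r = p * r + q * r.
Proof. quat_ring. Qed.

Lemma qmul_plus_r (p q r : quat) : p * (q + r) = p * q + p * r.
Proof. quat_ring. Qed.

Lemma qmul_scal_l (x : R) (p q : quat) : scal x p * q = scal x (p * q).
Proof. quat_ring. Qed.

Lemma qmul_scal_r (x : R) (p q : quat) : p * scal x q = scal x (p * q).
Proof. quat_ring. Qed.

Lemma qmul_zero_l (q : quat) : zero * q = zero.
Proof. quat_ring. Qed.

Lemma qmul_zero_r (q : quat) : q * zero = zero.
Proof. quat_ring. Qed.

Lemma qmul_1_l (q : quat) : qreal 1 * q = q.
Proof. quat_ring. Qed.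

Lemma qmul_1_r (q : quat) : q * qreal 1 = q.
Proof. quat_ring. Qed.

Lemma qmul_qreal_l (x : R) (q : quat) : qreal x * q = scal x q.
Proof. quat_ring. Qed.

Lemma qmul_qreal_comm (x : R) (q : quat) : qreal x * q = q * qreal x.
Proof. quat_ring. Qed.

Lemma qdot_plus_l (p q r : quat) : qdot (p + q) r = (qdot p r + qdot q r)%R.
Proof. quat_ring. Qed.

Lemma qdot_scal_l (x : R) (p q : quat) : qdot (scal x p) q = (x * qdot p q)%R.
Proof. quat_ring. Qed.

Lemma qdot_zero_l (q : quat) : qdot zero q = 0.
Proof. quat_ring. Qed.

Lemma qdot_mult_norm (p q : quat) : qdot (p * q) (p * q) = (qdot p p * qdot q q)%R.
Proof. quat_ring. Qed.

Lemma qdot_pos (q : quat) : 0 <= qdot q q.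
Proof. quat_unfold. nra. Qed.

(** The iterated product norm is Euclidean, which is what makes it multiplicative on quaternions. *)
Lemma norm_quat (q : quat) : norm q = sqrt (qdot q q).
Proof.
  destruct q as [[[a b] c] d].
  unfold qdot, qre, qim_i, qim_j, qim_k, norm; simpl. unfold prod_norm. simpl.
  unfold norm; simpl. unfold prod_norm; simpl.
  unfold norm; simpl. unfold prod_norm; simpl.
  unfold norm; simpl. unfold abs; simpl.
  assert (Habs : forall x, (Rabs x * (Rabs x * 1) = x * x)%R).
  { intros x. unfold Rabs. destruct (Rcase_abs x); ring. }
  rewrite !Habs, !Rmult_1_r, !sqrt_sqrt; [reflexivity| |].
  all: repeat rewrite ?sqrt_sqrt; nra.
Qed.

Lemma norm_qmul (p q : quat) : norm (p * q) = (norm p * norm q)%R.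
Proof.
  rewrite !norm_quat, qdot_mult_norm. apply sqrt_mult; apply qdot_pos.
Qed.

Lemma qdot_norm (p q : quat) : Rabs (qdot p q) <= norm p * norm q.
Proof.
  rewrite !norm_quat, <- sqrt_mult by apply qdot_pos.
  rewrite <- sqrt_Rsqr_abs. apply sqrt_le_1_alt.
  destruct p as [[[a b] c] d], q as [[[a' b'] c'] d'].
  unfold Rsqr, qdot, qre, qim_i, qim_j, qim_k; simpl.
  (* Lagrange's identity: this sum of squares equals |p|^2 |q|^2 - <p, q>^2. *)
  assert (0 <= (a * b' - b * a') * (a * b' - b * a') + (a * c' - c * a') * (a * c' - c * a')
    + (a * d' - d * a') * (a * d' - d * a') + (b * c' - c * b') * (b * c' - c * b')
    + (b * d' - d * b') * (b * d' - d * b') + (c * d' - d * c') * (c * d' - d * c'))%R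
    by (repeat apply Rplus_le_le_0_compat; apply Rle_0_sqr).
  nra.
Qed.

Definition q1 : quat := qreal 1.
Definition qi : quat := (0, 1, 0, 0).
Definition qj : quat := (0, 0, 1, 0).
Definition qk : quat := (0, 0, 0, 1).

(** Through this expansion limits, derivatives and series of quaternions reduce to real ones paired
    with a fixed p. *)
Lemma quat_decompose (q : quat) :
  q = scal (qdot q q1) q1 + scal (qdot q qi) qi + scal (qdot q qj) qj + scal (qdot q qk) qk.
Proof. unfold q1, qi, qj, qk. quat_ring. Qed.

Lemma qdot_eq (p q : quat) : (forall r, qdot p r = qdot q r) -> p = q.
Proof. intros H. rewrite (quat_decompose p), (quat_decompose q), !H. reflexivity. Qed.

Lemma qdot_qre (q : quat) : qdot q q1 = qre q.
Proof. unfold q1. quat_ring. Qed.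

Lemma qdot_qim_i (q : quat) : qdot q qi = qim_i q.
Proof. unfold qi. quat_ring. Qed.

Lemma qdot_qim_j (q : quat) : qdot q qj = qim_j q.
Proof. unfold qj. quat_ring. Qed.

Lemma qdot_qim_k (q : quat) : qdot q qk = qim_k q.
Proof. unfold qk. quat_ring. Qed.

Lemma norm_le_qdot (q : quat) :
  norm q <= Rabs (qdot q q1) + Rabs (qdot q qi) + Rabs (qdot q qj) + Rabs (qdot q qk).
Proof.
  assert (Hb : forall (p : quat) x, qdot p p = 1 -> norm (scal x p) = Rabs x).
  { intros p x Hp. rewrite norm_quat, qdot_scal_l.
    replace (qdot p (scal x p)) with (x * qdot p p)%R by (quat_unfold; ring).
    rewrite Hp, Rmult_1_r. apply sqrt_Rsqr_abs. }
  rewrite (quat_decompose q) at 1.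
  rewrite <- (Hb q1 (qdot q q1)), <- (Hb qi (qdot q qi)), <- (Hb qj (qdot q qj)),
    <- (Hb qk (qdot q qk)) by (unfold q1, qi, qj, qk; quat_unfold; ring).
  eapply Rle_trans; [apply @norm_triangle|]. apply Rplus_le_compat_r.
  eapply Rle_trans; [apply @norm_triangle|]. apply Rplus_le_compat_r.
  apply @norm_triangle.
Qed.

Lemma is_linear_qdot (p : quat) : is_linear (fun q : quat => qdot q p).
Proof.
  split.
  - intros x y. apply qdot_plus_l.
  - intros k x. apply qdot_scal_l.
  - exists (norm p + 1)%R. pose proof (norm_ge_0 p).
    split; [lra|]. intros x. pose proof (qdot_norm x p). pose proof (norm_ge_0 x).
    change (Rabs (qdot x p) <= (norm p + 1) * norm x). nra.
Qed.

Lemma filterlim_qdot {T} (F : (T -> Prop) -> Prop) {FF : Filter F} (h : T -> quat) (l : quat) :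
  filterlim h F (locally l) <->
  forall p, filterlim (fun x => qdot (h x) p) F (locally (qdot l p)).
Proof.
  split.
  - intros H p. apply (filterlim_comp T quat R h (fun q => qdot q p) F (locally l)); [exact H|].
    apply (linear_cont _ _ (is_linear_qdot p)).
  - intros H. rewrite (quat_decompose l).
    apply (filterlim_ext (fun x => scal (qdot (h x) q1) q1 + scal (qdot (h x) qi) qi
      + scal (qdot (h x) qj) qj + scal (qdot (h x) qk) qk)).
    { intros x. symmetry. apply quat_decompose. }
    assert (Hs : forall p, filterlim (fun x => scal (qdot (h x) p) p) F
                             (locally (scal (qdot l p) p))).
    { intros p.
      apply (filterlim_comp T R quat (fun x => qdot (h x) p) (fun x => scal x p) F
               (locally (qdot l p))); [apply H | apply (@filterlim_scal_l R_AbsRing quat_NM)]. }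
    assert (Hp : forall (g g' : T -> quat) (m m' : quat),
      filterlim g F (locally m) -> filterlim g' F (locally m') ->
      filterlim (fun x => g x + g' x) F (locally (m + m'))).
    { intros g g' m m' Hg Hg'. eapply filterlim_comp_2; [exact Hg | exact Hg' |].
      apply (@filterlim_plus R_AbsRing quat_NM). }
    apply Hp; [|apply Hs]. apply Hp; [|apply Hs]. apply Hp; apply Hs.
Qed.

Lemma is_derive_qdot (h : R -> quat) (t : R) (l : quat) :
  is_derive h t l <-> forall p, is_derive (fun s => qdot (h s) p) t (qdot l p).
Proof.
  split.
  - intros H p.
    pose proof (@filterdiff_comp' R_AbsRing R_NormedModule quat_NM R_NormedModule
      h (fun q => qdot q p) t _ _ H (filterdiff_linear _ (is_linear_qdot p))) as D.
    eapply filterdiff_ext_lin; [exact D|]. intros s. exact (qdot_scal_l s l p).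
  - intros H.
    assert (Hs : forall p, is_derive (fun s => scal (qdot (h s) p) p) t (scal (qdot l p) p)).
    { intros p. apply (@is_derive_scal_l R_AbsRing quat_NM). apply H. }
    rewrite (quat_decompose l).
    apply (is_derive_ext (fun s => scal (qdot (h s) q1) q1 + scal (qdot (h s) qi) qi
      + scal (qdot (h s) qj) qj + scal (qdot (h s) qk) qk)).
    { intros s. symmetry. apply quat_decompose. }
    apply @is_derive_plus; [|apply Hs]. apply @is_derive_plus; [|apply Hs].
    apply @is_derive_plus; apply Hs.
Qed.

Lemma is_derive_quat_unique (h : R -> quat) (t : R) (l : quat) :
  is_derive h t l -> QDerive h t = l.
Proof.
  intros H. rewrite is_derive_qdot in H. destruct l as [[[l0 l1] l2] l3].
  unfold QDerive. repeat apply (f_equal2 pair); apply is_derive_unique.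
  - apply (is_derive_ext (fun s => qdot (h s) q1)); [intros; apply qdot_qre|].
    pose proof (H q1) as H0. rewrite qdot_qre in H0. exact H0.
  - apply (is_derive_ext (fun s => qdot (h s) qi)); [intros; apply qdot_qim_i|].
    pose proof (H qi) as H0. rewrite qdot_qim_i in H0. exact H0.
  - apply (is_derive_ext (fun s => qdot (h s) qj)); [intros; apply qdot_qim_j|].
    pose proof (H qj) as H0. rewrite qdot_qim_j in H0. exact H0.
  - apply (is_derive_ext (fun s => qdot (h s) qk)); [intros; apply qdot_qim_k|].
    pose proof (H qk) as H0. rewrite qdot_qim_k in H0. exact H0.
Qed.

Lemma QDerive_correct (h : R -> quat) (t : R) :
  ex_derive h t -> is_derive h t (QDerive h t).
Proof. intros [l H]. rewrite (is_derive_quat_unique _ _ _ H). exact H. Qed.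

Lemma continuous_qdot {U : UniformSpace} (h : U -> quat) (x : U) :
  continuous h x <-> forall p, continuous (fun y => qdot (h y) p) x.
Proof. apply filterlim_qdot. apply locally_filter. Qed.

Lemma sum_n_qdot (a : nat -> quat) (p : quat) (N : nat) :
  qdot (sum_n a N) p = sum_n (fun n => qdot (a n) p) N.
Proof.
  induction N as [|N IH]; [rewrite !sum_O; reflexivity|].
  rewrite !sum_Sn, <- IH. apply qdot_plus_l.
Qed.

Lemma is_series_qdot (a : nat -> quat) (l : quat) :
  is_series a l <-> forall p, is_series (fun n => qdot (a n) p) (qdot l p).
Proof.
  assert (E := filterlim_qdot eventually (sum_n a) l).
  split.
  - intros H p. apply (filterlim_ext (fun N => qdot (sum_n a N) p)).
    + intros N. apply sum_n_qdot.
    + apply (proj1 E H p).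
  - intros H. apply (proj2 E). intros p.
    apply (filterlim_ext (sum_n (fun n => qdot (a n) p))).
    + intros N. symmetry. apply sum_n_qdot.
    + apply (H p).
Qed.

(** [class_C] and [dir_deriv] differentiate at parameter 0 only; moving the base point along the
    line gives every other parameter. *)
Lemma is_derive_shift_param (f : quat -> quat) (q v l : quat) (t : R) :
  is_derive (fun s => f (q + scal t v + scal s v)) 0 l ->
  is_derive (fun s => f (q + scal s v)) t l.
Proof.
  intros H.
  apply (is_derive_ext (fun s => f (q + scal t v + scal (s - t)%R v))).
  { intros s. f_equal. quat_ring. }
  replace l with (scal 1 l) by apply (@scal_one R_AbsRing quat_NM).
  apply (is_derive_comp (fun s => f (q + scal t v + scal s v)) (fun s => (s - t)%R)).
  - rewrite Rminus_eq_0. exact H.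
  - auto_derive; [trivial|ring].
Qed.

(** * Smooth functions on R^4 *)

(** Quantifying over all k at once serves the product rule: class k + 1 of a product calls for class
    k of the factors as well as of their derivatives, and the recursion of [class_C] passes on only
    the latter. *)
Definition smooth (f : quat -> quat) : Prop := forall k, class_C k f.

Lemma class_C_S (k : nat) (f : quat -> quat) :
  class_C (S k) f <-> forall v,
    (forall q, is_derive (fun t => f (q + scal t v)) 0 (dir_deriv v f q)) /\
    class_C k (dir_deriv v f).
Proof.
  simpl. split; intros H v; destruct (H v) as [H1 H2]; split; auto; intros q.
  - apply QDerive_correct, H1.
  - eexists. apply H1.
Qed.

Lemma smooth_continuous (f : quat -> quat) (q : quat) : smooth f -> continuous f q.
Proof. intros H. apply (H O). Qed.

Lemma smooth_dir_deriv (f : quat -> quat) (v : quat) : smooth f -> smooth (dir_deriv v f).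
Proof. intros H k. apply (H (S k)). Qed.

Lemma smooth_is_derive_0 (f : quat -> quat) (q v : quat) : smooth f ->
  is_derive (fun t => f (q + scal t v)) 0 (dir_deriv v f q).
Proof. intros H. specialize (H 1%nat). rewrite class_C_S in H. apply H. Qed.

Lemma smooth_is_derive (f : quat -> quat) (q v : quat) (t : R) : smooth f ->
  is_derive (fun t => f (q + scal t v)) t (dir_deriv v f (q + scal t v)).
Proof. intros H. apply is_derive_shift_param, smooth_is_derive_0, H. Qed.

Lemma dir_deriv_eq (f : quat -> quat) (q v l : quat) :
  is_derive (fun t => f (q + scal t v)) 0 l -> dir_deriv v f q = l.
Proof. apply is_derive_quat_unique. Qed.

Lemma plus_scal_0 (q v : quat) : q + scal 0 v = q.
Proof. quat_ring. Qed.

Lemma dir_deriv_plus (f g : quat -> quat) (v : quat) : smooth f -> smooth g ->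
  dir_deriv v (fun q => f q + g q) = (fun q => dir_deriv v f q + dir_deriv v g q).
Proof.
  intros Hf Hg. apply functional_extensionality. intros q. apply dir_deriv_eq.
  apply @is_derive_plus; apply smooth_is_derive_0; assumption.
Qed.

Lemma is_derive_qmul (f g : R -> quat) (t : R) (l m : quat) :
  is_derive f t l -> is_derive g t m ->
  is_derive (fun s => f s * g s) t (l * g t + f t * m).
Proof.
  rewrite !is_derive_qdot. intros Hf Hg p.
  (* Expanding f in the basis and using <e g, p> = <g, conj(e) p> turns the noncommutative product
     into a sum of products of real functions. *)
  apply (is_derive_ext (fun s => (
    qdot (f s) q1 * qdot (g s) (qconj q1 * p) + qdot (f s) qi * qdot (g s) (qconj qi * p)
    + qdot (f s) qj * qdot (g s) (qconj qj * p) + qdot (f s) qk * qdot (g s) (qconj qk * p))%R)).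
  { intros s. generalize (f s) (g s). unfold q1, qi, qj, qk. quat_ring. }
  assert (Hm : forall r r', is_derive (fun s => (qdot (f s) r * qdot (g s) r')%R) t
    (qdot l r * qdot (g t) r' + qdot (f t) r * qdot m r')%R).
  { intros r r'. apply (is_derive_mult (fun s => qdot (f s) r) (fun s => qdot (g s) r'));
      [apply Hf | apply Hg | intros; apply Rmult_comm]. }
  match goal with |- is_derive _ _ ?d => replace d with (
    (qdot l q1 * qdot (g t) (qconj q1 * p) + qdot (f t) q1 * qdot m (qconj q1 * p))
    + (qdot l qi * qdot (g t) (qconj qi * p) + qdot (f t) qi * qdot m (qconj qi * p))
    + (qdot l qj * qdot (g t) (qconj qj * p) + qdot (f t) qj * qdot m (qconj qj * p))
    + (qdot l qk * qdot (g t) (qconj qk * p) + qdot (f t) qk * qdot m (qconj qk * p)))%R end.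
  - apply @is_derive_plus; [|apply Hm]. apply @is_derive_plus; [|apply Hm].
    apply @is_derive_plus; apply Hm.
  - generalize (f t) (g t). unfold q1, qi, qj, qk. quat_ring.
Qed.

Lemma dir_deriv_qmul (f g : quat -> quat) (v : quat) : smooth f -> smooth g ->
  dir_deriv v (fun q => f q * g q) = (fun q => dir_deriv v f q * g q + f q * dir_deriv v g q).
Proof.
  intros Hf Hg. apply functional_extensionality. intros q. apply dir_deriv_eq.
  pose proof (is_derive_qmul _ _ _ _ _ (smooth_is_derive_0 f q v Hf)
    (smooth_is_derive_0 g q v Hg)) as H. cbv beta in H.
  rewrite plus_scal_0 in H. exact H.
Qed.

Lemma class_C_plus (k : nat) (f g : quat -> quat) :
  class_C k f -> class_C k g -> class_C k (fun q => f q + g q).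
Proof.
  revert f g. induction k as [|k IH]; intros f g Hf Hg.
  - intros q. apply (@continuous_plus _ R_AbsRing quat_NM); [apply Hf | apply Hg].
  - rewrite class_C_S in Hf, Hg. intros v.
    destruct (Hf v) as [Hf1 Hf2], (Hg v) as [Hg1 Hg2].
    assert (D : forall q, is_derive (fun t => f (q + scal t v) + g (q + scal t v)) 0
      (dir_deriv v f q + dir_deriv v g q)).
    { intros q. apply @is_derive_plus; [apply Hf1 | apply Hg1]. }
    split.
    + intros q. eexists. apply D.
    + replace (dir_deriv v (fun q => f q + g q))
        with (fun q => dir_deriv v f q + dir_deriv v g q); [apply IH; assumption|].
      apply functional_extensionality. intros q. symmetry. apply dir_deriv_eq, D.
Qed.

Lemma smooth_plus (f g : quat -> quat) :
  smooth f -> smooth g -> smooth (fun q => f q + g q).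
Proof. intros Hf Hg k. apply class_C_plus; auto. Qed.

Lemma continuous_qmul (f g : quat -> quat) (q : quat) :
  continuous f q -> continuous g q -> continuous (fun q => f q * g q) q.
Proof.
  intros Hf Hg. rewrite continuous_qdot in Hf, Hg. apply continuous_qdot. intros p.
  apply (continuous_ext (fun s => (
    qdot (f s) q1 * qdot (g s) (qconj q1 * p) + qdot (f s) qi * qdot (g s) (qconj qi * p)
    + qdot (f s) qj * qdot (g s) (qconj qj * p) + qdot (f s) qk * qdot (g s) (qconj qk * p))%R)).
  { intros s. generalize (f s) (g s). unfold q1, qi, qj, qk. quat_ring. }
  assert (Hm : forall r r', continuous (fun s => (qdot (f s) r * qdot (g s) r')%R) q).
  { intros r r'. apply (@continuous_mult _ R_AbsRing); [apply Hf | apply Hg]. }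
  apply (@continuous_plus _ R_AbsRing R_NormedModule); [|apply Hm].
  apply (@continuous_plus _ R_AbsRing R_NormedModule); [|apply Hm].
  apply (@continuous_plus _ R_AbsRing R_NormedModule); apply Hm.
Qed.

Lemma smooth_qmul (f g : quat -> quat) :
  smooth f -> smooth g -> smooth (fun q => f q * g q).
Proof.
  intros Hf Hg k. revert f g Hf Hg. induction k as [|k IH]; intros f g Hf Hg.
  - intros q. apply continuous_qmul; apply smooth_continuous; assumption.
  - intros v. split.
    + intros q. eexists.
      apply (is_derive_qmul _ _ _ _ _ (smooth_is_derive_0 f q v Hf)
        (smooth_is_derive_0 g q v Hg)).
    + rewrite dir_deriv_qmul by assumption.
      apply class_C_plus; apply IH; auto using smooth_dir_deriv.
Qed.

Lemma is_derive_affine (q v : quat) : is_derive (fun t => q + scal t v) 0 v.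
Proof.
  apply is_derive_qdot. intros p.
  apply (is_derive_ext (fun s => (qdot q p + s * qdot v p)%R)).
  { intros s. quat_ring. }
  auto_derive; [trivial|ring].
Qed.

Lemma dir_deriv_const (a v : quat) : dir_deriv v (fun _ => a) = (fun _ => zero).
Proof.
  apply functional_extensionality. intros q. apply dir_deriv_eq. apply @is_derive_const.
Qed.

Lemma smooth_const (a : quat) : smooth (fun _ => a).
Proof.
  intros k. revert a. induction k as [|k IH]; intros a.
  - intros q. apply continuous_const.
  - intros v. split.
    + intros q. eexists. apply @is_derive_const.
    + rewrite dir_deriv_const. apply IH.
Qed.

Lemma dir_deriv_id (v : quat) : dir_deriv v (fun q => q) = (fun _ => v).
Proof.
  apply functional_extensionality. intros q. apply dir_deriv_eq, is_derive_affine.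
Qed.

Lemma smooth_id : smooth (fun q => q).
Proof.
  intros [|k].
  - intros q. apply continuous_id.
  - intros v. split.
    + intros q. eexists. apply is_derive_affine.
    + rewrite dir_deriv_id. apply smooth_const.
Qed.

(** * Power series of slice regular functions *)

Lemma in_S_inv (I : quat) : in_S I -> qre I = 0 /\ qdot I I = 1.
Proof.
  destruct I as [[[a b] c] d]. unfold in_S, qmul, qreal, qdot, qre, qim_i, qim_j, qim_k. simpl.
  intros H. injection H as H0 H1 H2 H3.
  (* A nonzero real part would force b = c = d = 0 and then a^2 = -1. *)
  assert (Ha : a = 0).
  { destruct (Req_dec a 0) as [|Ha]; [assumption|exfalso].
    assert (b = 0) by (apply (Rmult_eq_reg_l a); lra).
    assert (c = 0) by (apply (Rmult_eq_reg_l a); lra).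
    assert (d = 0) by (apply (Rmult_eq_reg_l a); lra).
    subst. nra. }
  subst a. split; lra.
Qed.

Lemma quat_in_slice (q : quat) : exists I x y, in_S I /\ q = slice_point I x y.
Proof.
  destruct q as [[[a b] c] d].
  set (r := sqrt (b * b + c * c + d * d)).
  assert (Hr : (r * r = b * b + c * c + d * d)%R) by (apply sqrt_sqrt; nra).
  destruct (Req_dec r 0) as [H0|H0].
  (* A real quaternion lies on every slice; [qi] is an arbitrary choice. *)
  - rewrite H0 in Hr. exists qi, a, 0. split.
    + unfold in_S, qi. unfold qmul, qreal, qre, qim_i, qim_j, qim_k; simpl.
      repeat apply (f_equal2 pair); ring.
    + unfold qi. quat_unfold. repeat apply (f_equal2 pair); nra.
  - exists (0, (b / r)%R, (c / r)%R, (d / r)%R), a, r. split.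
    + unfold in_S. unfold qmul, qreal, qre, qim_i, qim_j, qim_k; simpl.
      repeat apply (f_equal2 pair); try (field; assumption).
      transitivity (- (b * b + c * c + d * d) / (r * r))%R; [field; assumption|].
      rewrite <- Hr. field. assumption.
    + quat_unfold. repeat apply (f_equal2 pair); field; assumption.
Qed.

Lemma qmul_slice_point (I : quat) (x y x' y' : R) : in_S I ->
  slice_point I x y * slice_point I x' y' = slice_point I (x * x' - y * y') (x * y' + y * x').
Proof.
  intros HI. unfold slice_point.
  rewrite !qmul_plus_l, !qmul_plus_r, !qmul_scal_l, !qmul_scal_r, HI.
  generalize I. quat_ring.
Qed.

Lemma qpow_slice_point (I : quat) (x y : R) (n : nat) : in_S I ->
  qpow (slice_point I x y) n = slice_point I (fst (cpow x y n)) (snd (cpow x y n)).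
Proof.
  intros HI. induction n as [|n IH].
  - simpl. generalize I. quat_ring.
  - simpl. rewrite IH, qmul_slice_point by exact HI. reflexivity.
Qed.

Lemma is_derive_slice_x (f : quat -> quat) (I : quat) (x y : R) (l : quat) :
  is_derive (fun t => f (slice_point I x y + scal t q1)) 0 l ->
  is_derive (fun s => f (slice_point I s y)) x l.
Proof.
  intros H.
  apply (is_derive_ext (fun s => f (slice_point I 0 y + scal s q1))).
  { intros s. f_equal. generalize I. unfold q1. quat_ring. }
  apply is_derive_shift_param.
  replace (slice_point I 0 y + scal x q1) with (slice_point I x y)
    by (generalize I; unfold q1; quat_ring).
  exact H.
Qed.

Lemma is_derive_slice_y (f : quat -> quat) (I : quat) (x y : R) (l : quat) :
  is_derive (fun t => f (slice_point I x y + scal t I)) 0 l ->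
  is_derive (fun s => f (slice_point I x s)) y l.
Proof.
  intros H.
  apply (is_derive_ext (fun s => f (slice_point I x 0 + scal s I))).
  { intros s. f_equal. generalize I. quat_ring. }
  apply is_derive_shift_param.
  replace (slice_point I x 0 + scal y I) with (slice_point I x y)
    by (generalize I; quat_ring).
  exact H.
Qed.

Lemma continuous_slice_point (I : quat) (z : R * R) :
  continuous (fun z : R * R => slice_point I (fst z) (snd z)) z.
Proof.
  apply continuous_qdot. intros p.
  apply (continuous_ext (fun z : R * R => (fst z * qre p + snd z * qdot I p)%R)).
  { intros [x y]. simpl. generalize I p. quat_ring. }
  apply (@continuous_plus _ R_AbsRing R_NormedModule);
    apply (@continuous_mult _ R_AbsRing); try apply continuous_const;
    [apply continuous_fst | apply continuous_snd].
Qed.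

Lemma slice_regular_derivatives (f : quat -> quat) (I : quat) (x y : R) :
  slice_regular f -> in_S I ->
  is_derive (fun s => f (slice_point I s y)) x (dir_deriv q1 f (slice_point I x y)) /\
  is_derive (fun s => f (slice_point I x s)) y (I * dir_deriv q1 f (slice_point I x y)).
Proof.
  intros [Hc Hd] HI. rewrite class_C_S in Hc.
  assert (Dx : is_derive (fun s => f (slice_point I s y)) x (dir_deriv q1 f (slice_point I x y)))
    by apply is_derive_slice_x, Hc.
  assert (Dy : is_derive (fun s => f (slice_point I x s)) y (dir_deriv I f (slice_point I x y)))
    by apply is_derive_slice_y, Hc.
  split; [exact Dx|].
  specialize (Hd I HI x y). simpl in Hd.
  unfold dbar, partial_x, partial_y, slice in Hd.
  assert (Ex : QDerive (fun s : R => f (slice_point I s y)) x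
               = dir_deriv q1 f (slice_point I x y)) by (apply is_derive_quat_unique, Dx).
  assert (Ey : QDerive (fun s : R => f (slice_point I x s)) y
               = dir_deriv I f (slice_point I x y)) by (apply is_derive_quat_unique, Dy).
  rewrite Ex, Ey in Hd.
  set (l := dir_deriv q1 f (slice_point I x y)) in *.
  set (m := dir_deriv I f (slice_point I x y)) in *.
  replace (I * l) with m; [exact Dy|].
  (* Multiplying the Cauchy-Riemann equation by I gives I l - m = 0. *)
  assert (E : I * (l + I * m) = zero).
  { replace (l + I * m) with (scal 2 (scal (1 / 2) (l + I * m)))
      by (generalize (l + I * m); intros [[[? ?] ?] ?]; quat_unfold;
          repeat apply (f_equal2 pair); field).
    rewrite Hd. generalize I. quat_ring. }
  rewrite qmul_plus_r, qmul_assoc, HI in E.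
  apply qdot_eq. intros r.
  apply (f_equal (fun q => qdot q r)) in E.
  rewrite qdot_plus_l, qmul_qreal_l, qdot_scal_l, qdot_zero_l in E. lra.
Qed.

(* Pairing with p turns left holomorphy along C_I into the Cauchy-Riemann system. *)
Lemma slice_regular_cauchy_riemann (f : quat -> quat) (I p : quat) :
  slice_regular f -> in_S I ->
  cauchy_riemann (fun x y => qdot (f (slice_point I x y)) p)
                 (fun x y => qdot (f (slice_point I x y)) (I * p))
                 (fun x y => qdot (dir_deriv q1 f (slice_point I x y)) p)
                 (fun x y => qdot (dir_deriv q1 f (slice_point I x y)) (I * p)).
Proof.
  intros Hf HI.
  destruct (in_S_inv I HI) as [I0 I1].
  assert (Hcont : forall r x y,
    continuity_2d_pt (fun x y => qdot (dir_deriv q1 f (slice_point I x y)) r) x y).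
  { intros r x y. apply continuity_2d_pt_filterlim.
    assert (Hc : continuous (dir_deriv q1 f) (slice_point I x y)).
    { destruct Hf as [Hc _]. apply (Hc q1). }
    rewrite continuous_qdot in Hc. specialize (Hc r).
    apply (continuous_comp (fun z : R * R => slice_point I (fst z) (snd z))
      (fun q => qdot (dir_deriv q1 f q) r) (x, y)).
    - apply continuous_slice_point.
    - exact Hc. }
  assert (Hdiff : forall r x y, differentiable_pt_lim (fun x y => qdot (f (slice_point I x y)) r)
    x y (qdot (dir_deriv q1 f (slice_point I x y)) r)
        (qdot (I * dir_deriv q1 f (slice_point I x y)) r)).
  { intros r x y. apply filterdiff_differentiable_pt_lim.
    (* Total differentiability needs the x-derivative nearby with continuity at the point, but the
       y-derivative at the point alone. *)
    pose proof (is_derive_filterdiff (fun x y => qdot (f (slice_point I x y)) r) x y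
      (fun x y => qdot (dir_deriv q1 f (slice_point I x y)) r)
      (qdot (I * dir_deriv q1 f (slice_point I x y)) r)) as D.
    apply D.
    - apply filter_forall. intros [s t]. simpl.
      apply (proj1 (is_derive_qdot _ _ _) (proj1 (slice_regular_derivatives f I s t Hf HI))).
    - apply (proj1 (is_derive_qdot _ _ _) (proj2 (slice_regular_derivatives f I x y Hf HI))).
    - specialize (Hcont r x y). apply continuity_2d_pt_filterlim in Hcont. exact Hcont. }
  split; [|split; [|split]]; try (intros x y; apply Hcont).
  - intros x y. specialize (Hdiff p x y).
    match goal with |- differentiable_pt_lim _ _ _ _ (- ?b)%R =>
      replace (- b)%R with (qdot (I * dir_deriv q1 f (slice_point I x y)) p); [exact Hdiff|] end.
    generalize (dir_deriv q1 f (slice_point I x y)). clear - I0.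
    destruct I as [[[a b] c] d]. simpl in I0. unfold qre in I0; simpl in I0. subst a. quat_ring.
  - intros x y. specialize (Hdiff (I * p) x y).
    match goal with |- differentiable_pt_lim _ _ _ _ ?b =>
      replace b with (qdot (I * dir_deriv q1 f (slice_point I x y)) (I * p)); [exact Hdiff|] end.
    transitivity (qdot I I * qdot (dir_deriv q1 f (slice_point I x y)) p)%R.
    + generalize (dir_deriv q1 f (slice_point I x y)), I, p. quat_ring.
    + rewrite I1. ring.
Qed.

Lemma CV_radius_pos (a : nat -> R) (rho C : R) : 0 < rho ->
  (forall n, Rabs (a n) <= C / rho ^ n) -> Rbar_lt 0 (CV_radius a).
Proof.
  intros Hrho Ha. apply Rbar_lt_le_trans with rho; [exact Hrho|].
  apply (proj1 (CV_radius_bounded a)). exists C. intros n.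
  assert (Hp : 0 < rho ^ n) by (apply pow_lt; exact Hrho).
  rewrite Rabs_mult, (Rabs_pos_eq (rho ^ n)) by lra.
  specialize (Ha n). apply (Rmult_le_compat_r (rho ^ n)) in Ha; [|lra].
  unfold Rdiv in Ha. rewrite Rmult_assoc, Rinv_l, Rmult_1_r in Ha by lra. exact Ha.
Qed.

(** The growth bound for every r is recorded beside convergence because termwise differentiation
    works from it directly. *)
Definition entire_with (A : nat -> quat) (f : quat -> quat) : Prop :=
  (forall r, 0 < r -> exists C, forall n, norm (A n) * r ^ n <= C) /\
  (forall q, is_series (fun n => qpow q n * A n) (f q)).

Definition entire (f : quat -> quat) : Prop := exists A, entire_with A f.

(* The coefficients on each slice are the Taylor coefficients along the real
   line, hence they depend neither on the slice nor on the radius. *)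
Lemma slice_regular_entire (f : quat -> quat) : slice_regular f -> entire f.
Proof.
  intros Hf.
  (* The real part of the n-th Taylor coefficient of <f, p> + i <f, I p> on C_I, computed on the
     circle of radius rho. *)
  set (c := fun (I : quat) (rho : R) (p : quat) (n : nat) =>
    coef rho (fun x y => qdot (f (slice_point I x y)) p)
             (fun x y => qdot (f (slice_point I x y)) (I * p)) n).
  assert (Hbound : forall I rho p, in_S I -> 0 < rho ->
    exists C, forall n, Rabs (c I rho p n) <= C / rho ^ n).
  { intros I rho p HI Hrho.
    pose proof (slice_regular_cauchy_riemann f I p Hf HI) as HCR.
    apply coef_bound; [exact Hrho| |]; intros x y.
    - eapply cauchy_riemann_continuous, HCR.
    - eapply cauchy_riemann_continuous, cauchy_riemann_mult_minus_i, HCR. }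
  assert (Hreal : forall I rho p x, in_S I -> 0 < rho -> Rabs x < rho ->
    is_pseries (c I rho p) x (qdot (f (qreal x)) p)).
  { intros I rho p x HI Hrho Hx.
    pose proof (slice_regular_cauchy_riemann f I p Hf HI) as HCR.
    assert (Hx2 : (x ^ 2 + 0 ^ 2 < rho ^ 2)%R).
    { apply Rabs_def2 in Hx. nra. }
    pose proof (cauchy_taylor _ _ _ _ rho x 0 HCR Hrho Hx2) as H.
    cbv beta in H.
    replace (slice_point I x 0) with (qreal x) in H by (generalize I; quat_ring).
    eapply is_series_ext; [|exact H]. intros n. cbv beta. rewrite cpow_real.
    change (pow_n x n) with (x ^ n)%R. unfold fst, snd, scal; simpl; unfold mult; simpl.
    unfold c. ring. }
  assert (HSi : in_S qi).
  { unfold in_S, qi, qmul, qreal, qre, qim_i, qim_j, qim_k; simpl.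
    repeat apply (f_equal2 pair); ring. }
  (* Slice [qi] and radius 1 are arbitrary; [HA] shows that every other choice gives the same
     coefficients, by comparing power series on the real line, which all slices share. *)
  set (A := fun n => (c qi 1%R q1 n, c qi 1%R qi n, c qi 1%R qj n, c qi 1%R qk n) : quat).
  assert (HA : forall I rho p n, in_S I -> 0 < rho -> c I rho p n = qdot (A n) p).
  { intros I rho p n HI Hrho.
    set (P := fun m => qdot (A m) p).
    destruct (Hbound I rho p HI Hrho) as [C HC].
    destruct (Hbound qi 1%R q1 HSi Rlt_0_1) as [C1 HC1].
    destruct (Hbound qi 1%R qi HSi Rlt_0_1) as [C2 HC2].
    destruct (Hbound qi 1%R qj HSi Rlt_0_1) as [C3 HC3].
    destruct (Hbound qi 1%R qk HSi Rlt_0_1) as [C4 HC4].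
    assert (HPs : forall x, Rabs x < 1 -> is_pseries P x (qdot (f (qreal x)) p)).
    { intros x Hx.
      pose proof (Hreal qi 1%R q1 x HSi Rlt_0_1 Hx) as S1.
      pose proof (Hreal qi 1%R qi x HSi Rlt_0_1 Hx) as S2.
      pose proof (Hreal qi 1%R qj x HSi Rlt_0_1 Hx) as S3.
      pose proof (Hreal qi 1%R qk x HSi Rlt_0_1 Hx) as S4.
      rewrite qdot_qre in S1. rewrite qdot_qim_i in S2.
      rewrite qdot_qim_j in S3. rewrite qdot_qim_k in S4.
      apply (is_series_scal_l (qre p)) in S1. apply (is_series_scal_l (qim_i p)) in S2.
      apply (is_series_scal_l (qim_j p)) in S3. apply (is_series_scal_l (qim_k p)) in S4.
      pose proof (is_series_plus _ _ _ _ (is_series_plus _ _ _ _ S1 S2)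
                    (is_series_plus _ _ _ _ S3 S4)) as S.
      match type of S with is_series _ ?l => replace (qdot (f (qreal x)) p) with l end.
      - eapply is_series_ext; [|exact S]. intros m. unfold P, A, qdot.
        unfold plus, scal; simpl; unfold mult; simpl.
        unfold qre, qim_i, qim_j, qim_k; simpl. change (pow_n x m) with (x ^ m)%R. ring.
      - unfold plus, scal; simpl. unfold mult; simpl. unfold qdot. ring. }
    apply (PSeries_ext_recip (c I rho p) P).
    - exact (CV_radius_pos _ rho C Hrho HC).
    - apply (CV_radius_pos _ 1 (Rabs (qre p) * C1 + Rabs (qim_i p) * C2
        + Rabs (qim_j p) * C3 + Rabs (qim_k p) * C4)%R Rlt_0_1).
      intros m. specialize (HC1 m). specialize (HC2 m). specialize (HC3 m). specialize (HC4 m).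
      rewrite pow1, Rdiv_1_r in *. unfold P, A, qdot.
      unfold qre at 1, qim_i at 1, qim_j at 1, qim_k at 1; simpl.
      repeat (eapply Rle_trans; [apply Rabs_triang|]; apply Rplus_le_compat);
        rewrite Rabs_mult, Rmult_comm; apply Rmult_le_compat_l; auto using Rabs_pos.
    - assert (Hm : 0 < Rmin rho 1) by (apply Rmin_pos; lra).
      exists (mkposreal _ Hm). intros x Hx.
      change (Rabs (x - 0) < Rmin rho 1) in Hx. rewrite Rminus_0_r in Hx.
      pose proof (Rmin_l rho 1). pose proof (Rmin_r rho 1).
      rewrite (is_pseries_unique _ _ _ (Hreal I rho p x HI Hrho ltac:(lra))).
      rewrite (is_pseries_unique _ _ _ (HPs x ltac:(lra))). reflexivity. }
  exists A. split.
  - intros r Hr.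
    destruct (Hbound qi r q1 HSi Hr) as [C1 HC1]. destruct (Hbound qi r qi HSi Hr) as [C2 HC2].
    destruct (Hbound qi r qj HSi Hr) as [C3 HC3]. destruct (Hbound qi r qk HSi Hr) as [C4 HC4].
    exists (C1 + C2 + C3 + C4)%R. intros n.
    specialize (HC1 n). specialize (HC2 n). specialize (HC3 n). specialize (HC4 n).
    rewrite HA in HC1, HC2, HC3, HC4 by assumption.
    assert (Hp : 0 < r ^ n) by (apply pow_lt; exact Hr).
    pose proof (norm_le_qdot (A n)).
    apply Rle_trans with ((C1 / r ^ n + C2 / r ^ n + C3 / r ^ n + C4 / r ^ n) * r ^ n)%R.
    + apply Rmult_le_compat_r; lra.
    + right. field. lra.
  - intros q. destruct (quat_in_slice q) as (I & x & y & HI & ->).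
    apply is_series_qdot. intros p.
    (* Any radius beyond |z| will do, since the coefficients do not depend on it. *)
    set (rho := (Rabs x + Rabs y + 1)%R).
    assert (Hrho : 0 < rho) by (unfold rho; pose proof (Rabs_pos x); pose proof (Rabs_pos y); lra).
    assert (Hz : (x ^ 2 + y ^ 2 < rho ^ 2)%R).
    { rewrite <- (pow2_abs x), <- (pow2_abs y). unfold rho.
      pose proof (Rabs_pos x). pose proof (Rabs_pos y). nra. }
    pose proof (slice_regular_cauchy_riemann f I p Hf HI) as HCR.
    pose proof (cauchy_taylor _ _ _ _ rho x y HCR Hrho Hz) as H.
    eapply is_series_ext; [|exact H]. intros n. cbv beta.
    fold (c I rho p n). rewrite HA by assumption.
    (* As I (I p) = - p, the imaginary part of the coefficient for p is the real part of the one for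
       I p. Since I is purely imaginary, X <A, p> - Y <A, I p> = <(X + Y I) A, p>. *)
    assert (E : coef rho (fun x y => qdot (f (slice_point I x y)) (I * p))
      (fun x y => - qdot (f (slice_point I x y)) p)%R n = qdot (A n) (I * p)).
    { rewrite <- (HA I rho) by assumption. unfold c. f_equal.
      apply functional_extensionality. intros s. apply functional_extensionality. intros t.
      rewrite qmul_assoc, HI. generalize (f (slice_point I s t)), p. quat_ring. }
    rewrite E, qpow_slice_point by exact HI.
    destruct (in_S_inv I HI) as [I0 _].
    generalize (A n), p, (fst (cpow x y n)), (snd (cpow x y n)). clear - I0.
    destruct I as [[[a b] c] d]. unfold qre in I0; simpl in I0. subst a. quat_ring.
Qed.

(** * Termwise differentiation *)

Lemma is_series_Rabs_le (a b : nat -> R) (l m : R) :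
  (forall n, Rabs (a n) <= b n) -> is_series a l -> is_series b m -> Rabs l <= m.
Proof.
  intros Hab Ha Hb.
  assert (Hex : ex_series (fun n => Rabs (a n))).
  { apply (@ex_series_le R_AbsRing R_CompleteNormedModule _ b).
    - intros n. change (Rabs (Rabs (a n)) <= b n). rewrite Rabs_Rabsolu. apply Hab.
    - exists m. exact Hb. }
  rewrite <- (is_series_unique _ _ Ha), <- (is_series_unique _ _ Hb).
  eapply Rle_trans; [apply Series_Rabs; exact Hex|].
  apply Series_le; [|exists m; exact Hb].
  intros n. split; [apply Rabs_pos | apply Hab].
Qed.

Lemma ex_series_quat_le (a : nat -> quat) (b : nat -> R) :
  (forall n, norm (a n) <= b n) -> ex_series b -> exists l : quat, is_series a l.
Proof.
  intros Hab Hb.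
  assert (Hp : forall p, is_series (fun n => qdot (a n) p) (Series (fun n => qdot (a n) p))).
  { intros p. apply Series_correct.
    apply (@ex_series_le R_AbsRing R_CompleteNormedModule _ (fun n => b n * norm p)%R).
    - intros n. change (Rabs (qdot (a n) p) <= b n * norm p).
      eapply Rle_trans; [apply qdot_norm|].
      apply Rmult_le_compat_r; [apply norm_ge_0 | apply Hab].
    - destruct Hb as [m Hb]. exists (m * norm p)%R.
      apply (is_series_ext (fun n => scal (norm p) (b n))).
      + intros n. apply Rmult_comm.
      + rewrite Rmult_comm. apply (@is_series_scal_l R_AbsRing R_NormedModule (norm p) b m Hb). }
  set (s := fun p => Series (fun n => qdot (a n) p)).
  exists (scal (s q1) q1 + scal (s qi) qi + scal (s qj) qj + scal (s qk) qk).
  apply is_series_qdot. intros p.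
  apply (is_series_ext (fun n => (qdot (a n) q1 * qdot q1 p + qdot (a n) qi * qdot qi p
    + qdot (a n) qj * qdot qj p + qdot (a n) qk * qdot qk p)%R)).
  { intros n. rewrite (quat_decompose (a n)) at 5. rewrite !qdot_plus_l, !qdot_scal_l.
    reflexivity. }
  rewrite !qdot_plus_l, !qdot_scal_l.
  assert (Hs : forall r, is_series (fun n => (qdot (a n) r * qdot r p)%R) (s r * qdot r p)%R).
  { intros r. rewrite Rmult_comm.
    apply (is_series_ext (fun n => scal (qdot r p) (qdot (a n) r))).
    - intros n. apply Rmult_comm.
    - exact (@is_series_scal_l R_AbsRing R_NormedModule (qdot r p) _ _ (Hp r)). }
  apply @is_series_plus; [|apply Hs]. apply @is_series_plus; [|apply Hs].
  apply @is_series_plus; apply Hs.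
Qed.

(** Two uses of the mean value theorem give h t - h 0 - t h'(0) = t (h'(c) - h'(0)) = t c h''(d)
    with |c| <= |t|. *)
Lemma taylor_2_bound (h dh ddh : R -> R) (M t : R) :
  (forall t, is_derive h t (dh t)) -> (forall t, is_derive dh t (ddh t)) ->
  (forall t, Rabs t <= 1 -> Rabs (ddh t) <= M) -> Rabs t <= 1 ->
  Rabs (h t - h 0 - t * dh 0) <= t ^ 2 * M.
Proof.
  intros Hh Hdh HM Ht.
  assert (Hbetween : forall s c, Rmin 0 s <= c <= Rmax 0 s -> Rabs c <= Rabs s).
  { intros s c. unfold Rmin, Rmax, Rabs.
    destruct (Rle_dec 0 s), (Rcase_abs c), (Rcase_abs s); lra. }
  assert (Hcont : forall (g dg : R -> R) s, (forall t, is_derive g t (dg t)) -> continuity_pt g s).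
  { intros g dg s Hg. apply continuity_pt_filterlim, (ex_derive_continuous g).
    exists (dg s). apply Hg. }
  destruct (MVT_gen h 0 t dh) as (c & Hc & Ec); [auto | intros; eapply Hcont, Hh |].
  destruct (MVT_gen dh 0 c ddh) as (d & Hd & Ed); [auto | intros; eapply Hcont, Hdh |].
  apply Hbetween in Hc, Hd.
  replace (h t - h 0 - t * dh 0)%R with (t * c * ddh d)%R by nra.
  rewrite !Rabs_mult, <- (pow2_abs t). simpl. rewrite Rmult_1_r.
  pose proof (Rabs_pos t). pose proof (Rabs_pos c). pose proof (Rabs_pos (ddh d)).
  apply Rmult_le_compat; [nra | lra | nra | apply HM; lra].
Qed.

(** Summable second-order bounds add up to |H t - H 0 - t L| <= t^2 m, which is differentiability at
    0 without any exchange of limits. *)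
Lemma is_derive_Series_0 (h dh ddh : nat -> R -> R) (M : nat -> R) (H : R -> R) (L : R) :
  (forall n t, is_derive (h n) t (dh n t)) -> (forall n t, is_derive (dh n) t (ddh n t)) ->
  (forall n t, Rabs t <= 1 -> Rabs (ddh n t) <= M n) -> ex_series M ->
  (forall t, is_series (fun n => h n t) (H t)) -> is_series (fun n => dh n 0) L ->
  is_derive H 0 L.
Proof.
  intros Hh Hdh HM [m Hm] HH HL.
  assert (Hb : forall t, Rabs t <= 1 -> Rabs (H t - H 0 - t * L) <= t ^ 2 * m).
  { intros t Ht.
    apply (is_series_Rabs_le (fun n => h n t - h n 0 - t * dh n 0)%R (fun n => t ^ 2 * M n)%R).
    - intros n. eapply taylor_2_bound; [apply Hh | apply Hdh | apply HM | exact Ht].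
    - apply @is_series_minus; [apply @is_series_minus; apply HH|].
      apply (@is_series_scal_l R_AbsRing R_NormedModule t (fun n => dh n 0) L HL).
    - apply (@is_series_scal_l R_AbsRing R_NormedModule (t ^ 2)%R M m Hm). }
  apply is_derive_Reals. intros eps Heps.
  assert (Hd : 0 < Rmin 1 (eps / (Rabs m + 1))).
  { apply Rmin_pos; [lra|]. apply Rdiv_lt_0_compat; [exact Heps|].
    pose proof (Rabs_pos m). lra. }
  exists (mkposreal _ Hd). intros t Ht0 Ht. simpl in Ht.
  pose proof (Rmin_l 1 (eps / (Rabs m + 1))). pose proof (Rmin_r 1 (eps / (Rabs m + 1))).
  specialize (Hb t ltac:(lra)). rewrite Rplus_0_l.
  assert (Hta : 0 < Rabs t) by (apply Rabs_pos_lt; exact Ht0).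
  apply Rmult_lt_reg_l with (Rabs t); [exact Hta|].
  rewrite <- Rabs_mult.
  replace (t * ((H t - H 0) / t - L))%R with (H t - H 0 - t * L)%R by (field; exact Ht0).
  rewrite <- (pow2_abs t) in Hb. eapply Rle_lt_trans; [exact Hb|].
  pose proof (Rabs_pos m). pose proof (Rle_abs m).
  assert (Rabs t * (Rabs m + 1) < eps)%R.
  { apply Rlt_le_trans with (eps / (Rabs m + 1) * (Rabs m + 1))%R.
    - apply Rmult_lt_compat_r; lra.
    - right. field. lra. }
  simpl. nra.
Qed.

(** * Uniform bounds for iterated directional derivatives *)

(** The same radius restricts points and directions; a given direction is accommodated by enlarging
    r. *)
Fixpoint deriv_bound (k : nat) (f : quat -> quat) (r M : R) : Prop :=
  match k with
  | O => forall q, norm q <= r -> norm (f q) <= M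
  | S k' => forall v, norm v <= r -> deriv_bound k' (dir_deriv v f) r M
  end.

Lemma deriv_bound_weaken (k : nat) (f : quat -> quat) (r r' M M' : R) :
  r' <= r -> M <= M' -> deriv_bound k f r M -> deriv_bound k f r' M'.
Proof.
  intros Hr HM. revert f. induction k as [|k IH]; intros f H q Hq; simpl in H.
  - eapply Rle_trans; [apply H; lra | exact HM].
  - apply IH, H. lra.
Qed.

Lemma deriv_bound_plus (k : nat) (f g : quat -> quat) (r M M' : R) :
  smooth f -> smooth g -> deriv_bound k f r M -> deriv_bound k g r M' ->
  deriv_bound k (fun q => f q + g q) r (M + M').
Proof.
  revert f g. induction k as [|k IH]; intros f g Sf Sg Hf Hg v Hv; simpl in Hf, Hg.
  - eapply Rle_trans; [apply @norm_triangle|]. apply Rplus_le_compat; auto.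
  - rewrite dir_deriv_plus by assumption. apply IH; auto using smooth_dir_deriv.
Qed.

(** Leibniz's rule produces 2^k terms; since they mix orders, both factors must be bounded at every
    order up to k. *)
Lemma deriv_bound_qmul (k : nat) (f g : quat -> quat) (r M M' : R) :
  smooth f -> smooth g ->
  (forall j, (j <= k)%nat -> deriv_bound j f r M) ->
  (forall j, (j <= k)%nat -> deriv_bound j g r M') ->
  deriv_bound k (fun q => f q * g q) r (2 ^ k * (M * M')).
Proof.
  revert f g. induction k as [|k IH]; intros f g Sf Sg Hf Hg v Hv.
  - specialize (Hf O (le_n _) v Hv). specialize (Hg O (le_n _) v Hv).
    rewrite norm_qmul, Rmult_1_l.
    apply Rmult_le_compat; auto; apply norm_ge_0.
  - rewrite dir_deriv_qmul by assumption.
    replace (2 ^ S k * (M * M'))%R with (2 ^ k * (M * M') + 2 ^ k * (M * M'))%R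
      by (simpl; ring).
    apply deriv_bound_plus; auto using smooth_qmul, smooth_dir_deriv.
    + apply IH; auto using smooth_dir_deriv. intros j Hj. apply (Hf (S j)); [lia | exact Hv].
    + apply IH; auto using smooth_dir_deriv. intros j Hj. apply (Hg (S j)); [lia | exact Hv].
Qed.

Lemma deriv_bound_const (k : nat) (a : quat) (r : R) :
  deriv_bound k (fun _ => a) r (norm a).
Proof.
  revert a. induction k as [|k IH]; intros a v Hv; [apply Rle_refl|].
  rewrite dir_deriv_const.
  apply (deriv_bound_weaken k _ r r (norm (zero : quat))); [lra | | apply IH].
  apply Rle_trans with 0; [right; exact (@norm_zero R_AbsRing quat_NM) | apply norm_ge_0].
Qed.

Lemma deriv_bound_id (k : nat) (r : R) : deriv_bound k (fun q => q) r r.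
Proof.
  destruct k as [|k]; intros v Hv; [exact Hv|].
  rewrite dir_deriv_id.
  apply (deriv_bound_weaken k _ r r (norm v)); [lra | exact Hv | apply deriv_bound_const].
Qed.

Lemma smooth_qpow (f : quat -> quat) (n : nat) :
  smooth f -> smooth (fun q => qpow (f q) n).
Proof.
  intros Hf. induction n as [|n IH]; simpl.
  - apply smooth_const.
  - apply smooth_qmul; assumption.
Qed.

Lemma norm_q1 : norm q1 = 1.
Proof.
  rewrite norm_quat. replace (qdot q1 q1) with 1; [apply sqrt_1|].
  unfold q1. quat_unfold. ring.
Qed.

(** Every derivative of q is bounded by r, and Leibniz costs at most 2^K per factor, so the bound is
    geometric in n. Fixing K gives one bound for all orders the induction meets; r + 1 keeps the
    base positive. *)
Lemma deriv_bound_qpow (K k n : nat) (r : R) : 0 <= r -> (k <= K)%nat ->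
  deriv_bound k (fun q => qpow q n) r ((2 ^ K * (r + 1)) ^ n).
Proof.
  intros Hr. revert k. induction n as [|n IH]; intros k Hk.
  - simpl. pose proof (deriv_bound_const k q1 r) as H. rewrite norm_q1 in H. exact H.
  - simpl qpow.
    apply (deriv_bound_weaken k _ r r (2 ^ k * (r * (2 ^ K * (r + 1)) ^ n))); [lra| |].
    + assert (H2 : 2 ^ k <= 2 ^ K) by (apply Rle_pow; [lra | exact Hk]).
      assert (H0 : 0 < 2 ^ k) by (apply pow_lt; lra).
      assert (HP : 0 <= (2 ^ K * (r + 1)) ^ n) by (apply pow_le; nra).
      simpl. rewrite <- Rmult_assoc. apply Rmult_le_compat_r; [exact HP|].
      apply Rmult_le_compat; lra.
    + apply deriv_bound_qmul.
      * apply smooth_id.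
      * apply smooth_qpow, smooth_id.
      * intros j _. apply deriv_bound_id.
      * intros j Hj. apply IH. lia.
Qed.

(** The hypothesis of the Weierstrass M-test for derivatives of every order on every ball. It is
    stable under [dir_deriv], so smoothness of the sum follows by induction on the order. *)
Definition summable_family (T : nat -> quat -> quat) : Prop :=
  (forall n, smooth (T n)) /\
  (forall k r, exists M, ex_series M /\ forall n, deriv_bound k (T n) r (M n)).

Lemma summable_family_dir_deriv (T : nat -> quat -> quat) (v : quat) :
  summable_family T -> summable_family (fun n => dir_deriv v (T n)).
Proof.
  intros [HS HT]. split.
  - intros n. apply smooth_dir_deriv, HS.
  - intros k r. destruct (HT (S k) (Rmax r (norm v))) as (M & HM & Hb).
    exists M. split; [exact HM|]. intros n.
    apply (deriv_bound_weaken k _ (Rmax r (norm v)) r (M n)); [apply Rmax_l | lra |].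
    apply (Hb n v), Rmax_r.
Qed.

Lemma summable_family_series (T : nat -> quat -> quat) (q : quat) :
  summable_family T -> exists l : quat, is_series (fun n => T n q) l.
Proof.
  intros [_ HT]. destruct (HT O (norm q)) as (M & HM & Hb).
  apply (ex_series_quat_le _ M); [|exact HM].
  intros n. apply (Hb n q). apply Rle_refl.
Qed.

Lemma summable_family_is_derive (T : nat -> quat -> quat) (G : quat -> quat) (q v l : quat) :
  summable_family T -> (forall q, is_series (fun n => T n q) (G q)) ->
  is_series (fun n => dir_deriv v (T n) q) l ->
  is_derive (fun t => G (q + scal t v)) 0 l.
Proof.
  intros HT HG Hl. apply is_derive_qdot. intros p.
  (* This radius contains the direction v and all points q + t v with |t| <= 1; order 2 feeds the
     second-order bound of [is_derive_Series_0]. *)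
  destruct (proj2 HT 2%nat (norm q + norm v)%R) as (M & [m HM] & Hb).
  pose proof (norm_ge_0 q) as Nq. pose proof (norm_ge_0 v) as Nv.
  apply (is_derive_Series_0
    (fun n t => qdot (T n (q + scal t v)) p)
    (fun n t => qdot (dir_deriv v (T n) (q + scal t v)) p)
    (fun n t => qdot (dir_deriv v (dir_deriv v (T n)) (q + scal t v)) p)
    (fun n => norm p * M n)%R).
  - intros n t. apply (proj1 (is_derive_qdot _ _ _)), smooth_is_derive, HT.
  - intros n t. apply (proj1 (is_derive_qdot _ _ _)), smooth_is_derive, smooth_dir_deriv, HT.
  - intros n t Ht. eapply Rle_trans; [apply qdot_norm|]. rewrite Rmult_comm.
    apply Rmult_le_compat_l; [apply norm_ge_0|].
    apply (Hb n v); [lra | lra |].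
    eapply Rle_trans; [apply @norm_triangle|]. apply Rplus_le_compat_l.
    eapply Rle_trans; [apply (@norm_scal R_AbsRing quat_NM)|].
    change (Rabs t * norm v <= norm v). nra.
  - exists (norm p * m)%R. apply (@is_series_scal_l R_AbsRing R_NormedModule (norm p) M m HM).
  - intros t. apply (proj1 (is_series_qdot _ _) (HG (q + scal t v))).
  - rewrite plus_scal_0. apply (proj1 (is_series_qdot _ _) Hl).
Qed.

Lemma summable_family_dir_deriv_series (T : nat -> quat -> quat) (G : quat -> quat) (q v : quat) :
  summable_family T -> (forall q, is_series (fun n => T n q) (G q)) ->
  is_series (fun n => dir_deriv v (T n) q) (dir_deriv v G q).
Proof.
  intros HT HG.
  destruct (summable_family_series _ q (summable_family_dir_deriv T v HT)) as [l Hl].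
  rewrite (dir_deriv_eq G q v l); [exact Hl|].
  eapply summable_family_is_derive; eassumption.
Qed.

Lemma plus_minus (p q : quat) : p + minus q p = q.
Proof. unfold minus. quat_ring. Qed.

(** The mean value theorem, applied to each term, gives a Lipschitz estimate at q whose constants
    are summable. *)
Lemma summable_family_continuous (T : nat -> quat -> quat) (G : quat -> quat) (q : quat) :
  summable_family T -> (forall q, is_series (fun n => T n q) (G q)) -> continuous G q.
Proof.
  intros HT HG. apply continuous_qdot. intros p.
  destruct (proj2 HT 1%nat (norm q + 1)%R) as (M & [m HM] & Hb).
  pose proof (norm_ge_0 q) as Nq. pose proof (norm_ge_0 p) as Np.
  assert (HLip : forall w : quat, 0 < norm w <= 1 ->
    Rabs (qdot (G (q + w)) p - qdot (G q) p) <= norm w * (norm p * m)).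
  { intros w Hw. set (s := norm w) in *.
    (* Normalising the increment keeps the direction inside the ball of radius |q| + 1, where the
       bound holds, and makes the factor |w| explicit. *)
    set (v := scal (/ s)%R w).
    assert (Hv : norm v <= 1).
    { eapply Rle_trans; [apply (@norm_scal R_AbsRing quat_NM)|].
      change (Rabs (/ s) * s <= 1). rewrite Rabs_pos_eq by (left; apply Rinv_0_lt_compat; lra).
      rewrite Rinv_l; lra. }
    replace w with (scal s v).
    2:{ unfold v. rewrite (@scal_assoc R_AbsRing quat_NM).
        change (scal (s * / s)%R w = w). rewrite Rinv_r by lra.
        apply (@scal_one R_AbsRing quat_NM). }
    apply (is_series_Rabs_le (fun n => qdot (T n (q + scal s v)%H) p - qdot (T n q) p)%R
      (fun n => s * (norm p * M n))%R).
    - intros n.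
      assert (D : forall t, is_derive (fun t => qdot (T n (q + scal t v)) p) t
        (qdot (dir_deriv v (T n) (q + scal t v)) p)).
      { intros t. apply (proj1 (is_derive_qdot _ _ _)), smooth_is_derive, HT. }
      destruct (MVT_gen (fun t => qdot (T n (q + scal t v)) p) 0 s
        (fun t => qdot (dir_deriv v (T n) (q + scal t v)) p)) as (c & Hc & Ec).
      + intros t _. apply D.
      + intros t _. apply continuity_pt_filterlim.
        apply (ex_derive_continuous (fun t => qdot (T n (q + scal t v)) p)).
        eexists. apply D.
      + rewrite plus_scal_0 in Ec. rewrite Ec, Rminus_0_r, Rabs_mult, (Rabs_pos_eq s) by lra.
        rewrite Rmin_left, Rmax_right in Hc by lra.
        rewrite Rmult_comm. apply Rmult_le_compat_l; [lra|].
        eapply Rle_trans; [apply qdot_norm|]. rewrite Rmult_comm.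
        apply Rmult_le_compat_l; [exact Np|].
        apply (Hb n v); [lra|].
        eapply Rle_trans; [apply @norm_triangle|]. apply Rplus_le_compat_l.
        eapply Rle_trans; [apply (@norm_scal R_AbsRing quat_NM)|].
        change (Rabs c * norm v <= 1). rewrite Rabs_pos_eq by lra.
        pose proof (norm_ge_0 v). nra.
    - apply @is_series_minus; apply (proj1 (is_series_qdot _ _)), HG.
    - apply (@is_series_scal_l R_AbsRing R_NormedModule s (fun n => norm p * M n)%R (norm p * m)%R),
        (@is_series_scal_l R_AbsRing R_NormedModule (norm p) M m HM). }
  apply filterlim_locally. intros eps.
  set (C := (Rabs (norm p * m) + 1)%R).
  assert (HC : 0 < C) by (unfold C; pose proof (Rabs_pos (norm p * m)); lra).
  assert (Hd : 0 < Rmin 1 (eps / C)).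
  { apply Rmin_pos; [lra|]. apply Rdiv_lt_0_compat; [apply cond_pos | exact HC]. }
  apply (locally_le_locally_norm (V := quat_NM)).
  exists (mkposreal _ Hd). intros q' Hq'.
  change (norm (minus q' q) < Rmin 1 (eps / C)) in Hq'.
  change (Rabs (qdot (G q') p - qdot (G q) p) < eps).
  pose proof (Rmin_l 1 (eps / C)). pose proof (Rmin_r 1 (eps / C)).
  set (w := minus q' q) in *.
  replace q' with (q + w) by (apply (plus_minus q q')).
  (* A zero increment has no direction to normalise. *)
  destruct (Req_dec (norm w) 0) as [Hw0|Hw0].
  - apply (@norm_eq_zero R_AbsRing quat_NM) in Hw0.
    assert (E : q + w = q) by (rewrite Hw0; apply (@plus_zero_r quat_NM)).
    rewrite E.
    rewrite (Rminus_eq_0 (qdot (G q) p)), Rabs_R0. apply cond_pos.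
  - assert (Hw : 0 < norm w) by (pose proof (norm_ge_0 w); lra).
    eapply Rle_lt_trans; [apply HLip; lra|].
    apply Rle_lt_trans with (norm w * C)%R.
    + apply Rmult_le_compat_l; [lra|]. unfold C. pose proof (Rle_abs (norm p * m)). lra.
    + apply Rlt_le_trans with (eps / C * C)%R; [apply Rmult_lt_compat_r; lra|].
      right. field. lra.
Qed.

Lemma summable_family_smooth (T : nat -> quat -> quat) (G : quat -> quat) :
  summable_family T -> (forall q, is_series (fun n => T n q) (G q)) -> smooth G.
Proof.
  intros HT HG k. revert T G HT HG. induction k as [|k IH]; intros T G HT HG.
  - intros q. eapply summable_family_continuous; eassumption.
  - intros v. split.
    + intros q. eexists. eapply summable_family_is_derive; [eassumption..|].
      eapply summable_family_dir_deriv_series; eassumption.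
    + apply (IH (fun n => dir_deriv v (T n))).
      * apply summable_family_dir_deriv, HT.
      * intros q. apply summable_family_dir_deriv_series; assumption.
Qed.

Lemma entire_summable (A : nat -> quat) (f : quat -> quat) :
  entire_with A f -> summable_family (fun n q => qpow q n * A n).
Proof.
  intros [HA _]. split.
  - intros n. apply smooth_qmul; [apply smooth_qpow, smooth_id | apply smooth_const].
  - intros k r.
    (* The bound for powers asks for a nonnegative radius. *)
    set (r' := Rmax r 0). set (B := (2 ^ k * (r' + 1))%R).
    assert (Hr' : 0 <= r') by apply Rmax_r.
    assert (HB : 0 < B).
    { unfold B. apply Rmult_lt_0_compat; [apply pow_lt; lra | lra]. }
    (* The derivatives of q^n grow like B^n; coefficient growth taken at 2 B leaves the summable
       factor 2^(-n). *)
    destruct (HA (2 * B)%R ltac:(lra)) as [C HC].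
    exists (fun n => (2 ^ k * C) * (/ 2) ^ n)%R. split.
    + eexists. apply (@is_series_scal_l R_AbsRing R_NormedModule (2 ^ k * C)%R (fun n => (/ 2) ^ n)%R
        (/ (1 - / 2))%R), is_series_geom.
      rewrite Rabs_pos_eq; lra.
    + intros n.
      apply (deriv_bound_weaken k _ r' r (2 ^ k * (B ^ n * norm (A n)))); [apply Rmax_l| |].
      * rewrite Rmult_assoc. apply Rmult_le_compat_l; [apply pow_le; lra|].
        specialize (HC n). rewrite Rpow_mult_distr in HC.
        apply (Rmult_le_compat_r ((/ 2) ^ n)) in HC; [|apply pow_le; lra].
        replace (B ^ n * norm (A n))%R
          with (norm (A n) * (2 ^ n * B ^ n) * (/ 2) ^ n)%R; [exact HC|].
        rewrite pow_inv. field. apply pow_nonzero. lra.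
      * apply deriv_bound_qmul.
        -- apply smooth_qpow, smooth_id.
        -- apply smooth_const.
        -- intros j Hj. apply deriv_bound_qpow; assumption.
        -- intros j _. apply deriv_bound_const.
Qed.

Lemma entire_smooth (f : quat -> quat) : entire f -> smooth f.
Proof.
  intros [A HA]. apply (summable_family_smooth (fun n q => qpow q n * A n)).
  - eapply entire_summable, HA.
  - apply HA.
Qed.

(** * Derivatives of power series *)

(** Pairing with an arbitrary functional turns a real-linear identity between quaternions into one
    for [lra], with products treated as atoms. *)
Ltac quat_linear :=
  apply qdot_eq; intros;
  rewrite ?qmul_qreal_l, ?qdot_plus_l, ?qdot_scal_l, ?qdot_plus_l, ?qdot_scal_l,
    ?qdot_plus_l, ?qdot_scal_l, ?qdot_plus_l, ?qdot_scal_l;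
  lra.

(** In general the derivative is the sum of q^i v q^(n-1-i); commutation makes these terms equal.
    For n = 0 the value of [pred] is harmless, as the factor [INR 0] vanishes. *)
Lemma dir_deriv_qpow_comm (q v : quat) (n : nat) : q * v = v * q ->
  dir_deriv v (fun q => qpow q n) q = scal (INR n) (v * qpow q (pred n)).
Proof.
  intros Hqv. induction n as [|n IH].
  - simpl qpow. rewrite dir_deriv_const. quat_ring.
  - simpl qpow at 1.
    rewrite (dir_deriv_qmul (fun q => q) (fun q => qpow q n)), dir_deriv_id, IH, S_INR
      by auto using smooth_id, smooth_qpow.
    rewrite qmul_scal_r, qmul_assoc, Hqv, <- qmul_assoc.
    destruct n as [|n]; simpl Nat.pred.
    + simpl INR. generalize (qpow q 0), (q * qpow q 0). quat_ring.
    + change (q * qpow q n) with (qpow q (S n)).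
      generalize (v * qpow q (S n)). intros w. generalize (INR (S n)). quat_ring.
Qed.

Lemma dir_deriv_qmul_const_r (f : quat -> quat) (a v : quat) : smooth f ->
  dir_deriv v (fun q => f q * a) = (fun q => dir_deriv v f q * a).
Proof.
  intros Hf. rewrite (dir_deriv_qmul f (fun _ => a)) by auto using smooth_const.
  apply functional_extensionality. intros q. rewrite dir_deriv_const, qmul_zero_r.
  apply (@plus_zero_r quat_NM).
Qed.

Lemma dir_deriv_qmul_const_l (f : quat -> quat) (a v : quat) : smooth f ->
  dir_deriv v (fun q => a * f q) = (fun q => a * dir_deriv v f q).
Proof.
  intros Hf. rewrite (dir_deriv_qmul (fun _ => a) f) by auto using smooth_const.
  apply functional_extensionality. intros q. rewrite dir_deriv_const, qmul_zero_l.
  apply (@plus_zero_l quat_NM).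
Qed.

(** It holds for each monomial with a right coefficient, and both sides are sums of the termwise
    derivatives. With v = I on C_I this is the Cauchy-Riemann equation. *)
Lemma entire_dir_deriv_comm (f : quat -> quat) (q v : quat) : entire f ->
  q * v = v * q -> dir_deriv v f q = v * dir_deriv q1 f q.
Proof.
  intros [A HA] Hqv.
  pose proof (entire_summable A f HA) as HT.
  pose proof (summable_family_dir_deriv_series _ f q v HT (proj2 HA)) as Sv.
  pose proof (summable_family_dir_deriv_series _ f q q1 HT (proj2 HA)) as S1.
  apply qdot_eq. intros p.
  (* Left multiplication by v moves to the functional, so that two real series can be compared. *)
  transitivity (qdot (dir_deriv q1 f q) (qconj v * p)).
  2:{ generalize (dir_deriv q1 f q). quat_ring. }
  rewrite is_series_qdot in Sv, S1. specialize (Sv p). specialize (S1 (qconj v * p)).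
  rewrite <- (is_series_unique _ _ Sv), <- (is_series_unique _ _ S1).
  apply Series_ext. intros n.
  rewrite !dir_deriv_qmul_const_r by auto using smooth_qpow, smooth_id.
  rewrite !dir_deriv_qpow_comm by (assumption || (unfold q1; symmetry; apply qmul_qreal_comm)).
  unfold q1. rewrite qmul_1_l. generalize (qpow q (Nat.pred n)), (A n), (INR n). quat_ring.
Qed.

Lemma entire_dir_deriv_1 (f : quat -> quat) : entire f -> entire (dir_deriv q1 f).
Proof.
  intros [A HA]. exists (fun n => scal (INR (S n)) (A (S n))). split.
  (* The bound is taken at 2 r because the factor n + 1 of the new coefficient is at most
     2^(n+1). *)
  - intros r Hr. destruct (proj1 HA (2 * r)%R ltac:(lra)) as [C HC].
    exists (C / r)%R. intros n. specialize (HC (S n)).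
    assert (Hn : INR (S n) <= 2 ^ S n).
    { clear. induction n as [|n IH]; [simpl; lra|].
      rewrite S_INR. assert (1 <= 2 ^ S n) by (apply pow_R1_Rle; lra).
      change (2 ^ S (S n))%R with (2 * 2 ^ S n)%R. lra. }
    eapply Rle_trans.
    { apply Rmult_le_compat_r; [apply pow_le; lra|].
      apply (@norm_scal R_AbsRing quat_NM). }
    change (Rabs (INR (S n)) * norm (A (S n)) * r ^ n <= C / r).
    rewrite Rabs_pos_eq by apply pos_INR.
    apply Rmult_le_reg_r with r; [exact Hr|].
    unfold Rdiv. rewrite Rmult_assoc, Rmult_assoc, Rmult_assoc, Rinv_l, Rmult_1_r by lra.
    eapply Rle_trans; [|exact HC].
    rewrite Rpow_mult_distr.
    replace (r ^ n * r)%R with (r ^ S n)%R by (simpl; ring).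
    pose proof (norm_ge_0 (A (S n))) as N0. assert (0 <= r ^ S n) by (apply pow_le; lra).
    replace (norm (A (S n)) * (2 ^ S n * r ^ S n))%R
      with (2 ^ S n * (norm (A (S n)) * r ^ S n))%R by ring.
    apply Rmult_le_compat_r; [|exact Hn]. nra.
  - intros q.
    pose proof (summable_family_dir_deriv_series _ f q q1 (entire_summable A f HA) (proj2 HA)) as S1.
    assert (Hterm : forall n, dir_deriv q1 (fun q => qpow q n * A n) q
                              = scal (INR n) (qpow q (pred n)) * A n).
    { intros n. rewrite dir_deriv_qmul_const_r by auto using smooth_qpow, smooth_id.
      rewrite dir_deriv_qpow_comm by (unfold q1; symmetry; apply qmul_qreal_comm).
      unfold q1. rewrite qmul_1_l. reflexivity. }
    apply is_series_qdot. intros p. rewrite is_series_qdot in S1. specialize (S1 p).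
    apply (is_series_ext (fun n => qdot (dir_deriv q1 (fun q => qpow q (S n) * A (S n)) q) p)).
    { intros n. rewrite Hterm. simpl Nat.pred.
      generalize (qpow q n), (A (S n)), (INR (S n)). quat_ring. }
    (* The index shift drops only the derivative of the constant term, which is zero. *)
    apply (is_series_incr_1
      (fun n => qdot (dir_deriv q1 (fun q => qpow q n * A n) q) p)).
    match goal with |- is_series _ ?l => replace l with (qdot (dir_deriv q1 f q) p) end.
    + exact S1.
    + rewrite Hterm. simpl INR. unfold plus; simpl.
      rewrite qmul_scal_l, qdot_scal_l. ring.
Qed.

(** * Iterated Cauchy-Riemann operators on a slice *)

(* Left holomorphy on C_I only, for a function defined on the whole of H. *)
Definition left_holomorphic (I : quat) (f : quat -> quat) : Prop :=
  smooth f /\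
  forall x y, dir_deriv I f (slice_point I x y) = I * dir_deriv q1 f (slice_point I x y).

Lemma slice_point_comm (I : quat) (x y : R) : slice_point I x y * I = I * slice_point I x y.
Proof. generalize I. quat_ring. Qed.

Lemma entire_left_holomorphic (f : quat -> quat) (I : quat) :
  entire f -> left_holomorphic I f.
Proof.
  intros Hf. split; [apply entire_smooth, Hf|].
  intros x y. apply entire_dir_deriv_comm; [exact Hf | apply slice_point_comm].
Qed.

(** A lift of [dbar] to functions on the whole of H, so that iterates stay smooth there and obey the
    product rule. The 1/2 is a quaternion factor so that [smooth_qmul] covers it. *)
Definition dbar_ambient (I : quat) (f : quat -> quat) (q : quat) : quat :=
  qreal (1 / 2) * (dir_deriv q1 f q + I * dir_deriv I f q).

Lemma smooth_dbar_ambient (I : quat) (f : quat -> quat) :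
  smooth f -> smooth (dbar_ambient I f).
Proof.
  intros Hf. apply smooth_qmul; [apply smooth_const|].
  apply smooth_plus; [apply smooth_dir_deriv, Hf|].
  apply smooth_qmul; [apply smooth_const | apply smooth_dir_deriv, Hf].
Qed.

Lemma partial_x_slice (I : quat) (f : quat -> quat) : smooth f ->
  partial_x (slice I f) = slice I (dir_deriv q1 f).
Proof.
  intros Hf. apply functional_extensionality. intros x.
  apply functional_extensionality. intros y.
  apply is_derive_quat_unique, is_derive_slice_x, smooth_is_derive_0, Hf.
Qed.

Lemma partial_y_slice (I : quat) (f : quat -> quat) : smooth f ->
  partial_y (slice I f) = slice I (dir_deriv I f).
Proof.
  intros Hf. apply functional_extensionality. intros x.
  apply functional_extensionality. intros y.
  apply is_derive_quat_unique, is_derive_slice_y, smooth_is_derive_0, Hf.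
Qed.

Lemma dbar_slice (I : quat) (f : quat -> quat) : smooth f ->
  dbar I (slice I f) = slice I (dbar_ambient I f).
Proof.
  intros Hf. unfold dbar. rewrite partial_x_slice, partial_y_slice by exact Hf.
  apply functional_extensionality. intros x. apply functional_extensionality. intros y.
  symmetry. apply qmul_qreal_l.
Qed.

Lemma slice_eq (I : quat) (f g : quat -> quat) :
  (forall x y, f (slice_point I x y) = g (slice_point I x y)) -> slice I f = slice I g.
Proof.
  intros H. apply functional_extensionality. intros x. apply functional_extensionality. intros y.
  apply H.
Qed.

(** Order k corresponds to level k - 1 of [SR]. It is an equality of functions so that it can be
    rewritten under further applications of [dbar]. *)
Definition polyholomorphic (I : quat) (k : nat) (f : quat -> quat) : Prop :=
  Nat.iter k (dbar I) (slice I f) = slice I (fun _ => zero).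

(** [dbar] sees only the slice, so g has to match the ambient derivative on C_I only; this admits
    formulas that fail off C_I. *)
Lemma polyholomorphic_S (I : quat) (k : nat) (f g : quat -> quat) : smooth f ->
  slice I (dbar_ambient I f) = slice I g ->
  polyholomorphic I (S k) f <-> polyholomorphic I k g.
Proof.
  intros Hf Hg. unfold polyholomorphic. rewrite Nat.iter_succ_r, dbar_slice, Hg by exact Hf.
  reflexivity.
Qed.

Lemma dbar_ambient_zero (I : quat) : dbar_ambient I (fun _ => zero) = (fun _ => zero).
Proof.
  apply functional_extensionality. intros q. unfold dbar_ambient.
  rewrite !dir_deriv_const. generalize I. quat_ring.
Qed.

Lemma polyholomorphic_weaken (I : quat) (k k' : nat) (f : quat -> quat) :
  (k <= k')%nat -> polyholomorphic I k f -> polyholomorphic I k' f.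
Proof.
  unfold polyholomorphic. intros Hk H. induction Hk as [|k' Hk IH]; [exact H|].
  simpl. rewrite IH, dbar_slice, dbar_ambient_zero by apply smooth_const. reflexivity.
Qed.

Lemma dbar_ambient_plus (I : quat) (f g : quat -> quat) : smooth f -> smooth g ->
  dbar_ambient I (fun q => f q + g q) = (fun q => dbar_ambient I f q + dbar_ambient I g q).
Proof.
  intros Hf Hg. apply functional_extensionality. intros q. unfold dbar_ambient.
  rewrite !dir_deriv_plus by assumption.
  rewrite (qmul_plus_r I). quat_linear.
Qed.

Lemma polyholomorphic_plus (I : quat) (k : nat) (f g : quat -> quat) : smooth f -> smooth g ->
  polyholomorphic I k f -> polyholomorphic I k g -> polyholomorphic I k (fun q => f q + g q).
Proof.
  revert f g. induction k as [|k IH]; intros f g Sf Sg Hf Hg.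
  - unfold polyholomorphic in *. simpl in *. apply slice_eq. intros x y.
    change (f (slice_point I x y)) with (slice I f x y).
    change (g (slice_point I x y)) with (slice I g x y).
    rewrite Hf, Hg. unfold slice. apply (@plus_zero_r quat_NM).
  - rewrite (polyholomorphic_S I k f (dbar_ambient I f)) in Hf by (assumption || reflexivity).
    rewrite (polyholomorphic_S I k g (dbar_ambient I g)) in Hg by (assumption || reflexivity).
    apply (polyholomorphic_S I k _ (fun q => dbar_ambient I f q + dbar_ambient I g q)).
    + apply smooth_plus; assumption.
    + rewrite dbar_ambient_plus by assumption. reflexivity.
    + apply IH; auto using smooth_dbar_ambient.
Qed.

(** * Multiplication by powers of the conjugate *)

Lemma dir_deriv_qconj (v q : quat) : dir_deriv v qconj q = qconj v.
Proof.
  apply dir_deriv_eq.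
  apply (is_derive_ext (fun t => qconj q + scal t (qconj v))); [|apply is_derive_affine].
  intros t. quat_ring.
Qed.

(** Conjugation is - 1/2 (q + i q i + j q j + k q k), hence covered by the rules for sums and
    products. *)
Lemma smooth_qconj : smooth qconj.
Proof.
  replace qconj with (fun q => qreal (- (1 / 2)) * (q + qi * q * qi + qj * q * qj + qk * q * qk)).
  - apply smooth_qmul; [apply smooth_const|].
    repeat apply smooth_plus; try apply smooth_id;
      (apply smooth_qmul; [|apply smooth_const]);
      (apply smooth_qmul; [apply smooth_const | apply smooth_id]).
  - apply functional_extensionality. unfold qi, qj, qk. intros q.
    quat_unfold. repeat apply (f_equal2 pair); field.
Qed.

(** On C_I the conjugate has dbar equal to 1 and commutes with I, so dbar (conj q * h) = h + conj q
    * dbar h; the second summand is handled by induction. *)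
Lemma polyholomorphic_qconj_mul (I : quat) (k : nat) (h : quat -> quat) : in_S I -> smooth h ->
  polyholomorphic I k h -> polyholomorphic I (S k) (fun q => qconj q * h q).
Proof.
  intros HI. destruct (in_S_inv I HI) as [I0 I1].
  revert h. induction k as [|k IH]; intros h Sh Hh.
  - apply (polyholomorphic_weaken I 0); [lia|].
    unfold polyholomorphic in *. simpl in *. apply slice_eq. intros x y.
    change (h (slice_point I x y)) with (slice I h x y). rewrite Hh.
    unfold slice. apply qmul_zero_r.
  - apply (polyholomorphic_S I (S k) _ (fun q => h q + qconj q * dbar_ambient I h q)).
    + apply smooth_qmul; [apply smooth_qconj | exact Sh].
    + apply slice_eq. intros x y. unfold dbar_ambient.
      rewrite !dir_deriv_qmul, !dir_deriv_qconj by auto using smooth_qconj.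
      set (u := dir_deriv q1 h _). set (w := dir_deriv I h _). set (l := h _).
      clearbody u w l.
      assert (EI : I * qconj I = q1).
      { unfold q1. rewrite <- I1. clear - I0. destruct I as [[[a b] c] d].
        unfold qre in I0; simpl in I0. subst a. quat_ring. }
      assert (Ez : I * qconj (slice_point I x y) = qconj (slice_point I x y) * I).
      { clear - I0. destruct I as [[[a b] c] d].
        unfold qre in I0; simpl in I0. subst a. quat_ring. }
      replace (qconj q1) with q1 by (unfold q1; quat_ring).
      rewrite (qmul_plus_r I), !qmul_assoc, EI, Ez. unfold q1.
      rewrite !qmul_1_l, <- !(qmul_assoc (qconj (slice_point I x y))),
        (qmul_assoc (qconj (slice_point I x y)) (qreal (1 / 2))),
        <- (qmul_qreal_comm _ (qconj (slice_point I x y))),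
        <- (qmul_assoc (qreal (1 / 2)) (qconj (slice_point I x y))),
        (qmul_plus_r (qconj (slice_point I x y))).
      quat_linear.
    + apply polyholomorphic_plus.
      * exact Sh.
      * apply smooth_qmul; [apply smooth_qconj | apply smooth_dbar_ambient, Sh].
      * exact Hh.
      * apply IH; [apply smooth_dbar_ambient, Sh|].
        apply (polyholomorphic_S I k h); [exact Sh | reflexivity | exact Hh].
Qed.

Lemma polyholomorphic_qpow_qconj_mul (I : quat) (p k : nat) (h : quat -> quat) :
  in_S I -> smooth h -> polyholomorphic I k h ->
  polyholomorphic I (p + k) (fun q => qpow (qconj q) p * h q).
Proof.
  intros HI Sh Hh. induction p as [|p IH].
  - simpl. replace (fun q => qreal 1 * h q) with h; [exact Hh|].
    apply functional_extensionality. intros q. symmetry. apply qmul_1_l.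
  - simpl plus.
    replace (fun q => qpow (qconj q) (S p) * h q)
      with (fun q => qconj q * (qpow (qconj q) p * h q)).
    + apply polyholomorphic_qconj_mul; [exact HI | | exact IH].
      apply smooth_qmul; [apply smooth_qpow, smooth_qconj | exact Sh].
    + apply functional_extensionality. intros q. apply qmul_assoc.
Qed.

(* On C_I this is the part of f that anticommutes with I, that is G J in the
   splitting f = F + G J. *)
Definition anti (I : quat) (f : quat -> quat) (q : quat) : quat :=
  qreal (1 / 2) * (f q + I * f q * I).

(** The component F of the splitting; the factor [qreal (-1) * I] makes it, like [anti], an instance
    of [left_holomorphic_comb]. *)
Definition commuting_part (I : quat) (f : quat -> quat) (q : quat) : quat :=
  qreal (1 / 2) * (f q + qreal (-1) * I * f q * I).

(** Right multiplication by a constant, and left multiplication by one that commutes with I,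
    preserve the Cauchy-Riemann equation. *)
Lemma left_holomorphic_comb (I c : quat) (f : quat -> quat) : c * I = I * c ->
  left_holomorphic I f -> left_holomorphic I (fun q => qreal (1 / 2) * (f q + c * f q * I)).
Proof.
  intros Hc [Sf Hf].
  assert (Sc : smooth (fun q => c * f q)) by (apply smooth_qmul; auto using smooth_const).
  assert (Sci : smooth (fun q => c * f q * I)) by (apply smooth_qmul; auto using smooth_const).
  split.
  - apply smooth_qmul; [apply smooth_const|]. apply smooth_plus; assumption.
  - intros x y.
    rewrite !dir_deriv_qmul_const_l by (apply smooth_plus; assumption).
    rewrite !dir_deriv_plus by assumption.
    rewrite !(dir_deriv_qmul_const_r (fun q => c * f q)) by assumption.
    rewrite !(dir_deriv_qmul_const_l f) by assumption. rewrite Hf.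
    set (u := dir_deriv q1 f _). clearbody u.
    rewrite (qmul_assoc I (qreal (1 / 2))), <- (qmul_qreal_comm (1 / 2) I),
      <- (qmul_assoc (qreal (1 / 2)) I).
    f_equal. rewrite qmul_plus_r, !qmul_assoc, Hc. reflexivity.
Qed.

Lemma left_holomorphic_anti (I : quat) (f : quat -> quat) :
  left_holomorphic I f -> left_holomorphic I (anti I f).
Proof. apply left_holomorphic_comb. reflexivity. Qed.

Lemma left_holomorphic_commuting_part (I : quat) (f : quat -> quat) :
  left_holomorphic I f -> left_holomorphic I (commuting_part I f).
Proof.
  apply left_holomorphic_comb. rewrite <- qmul_assoc, qmul_qreal_comm, <- qmul_assoc.
  rewrite (qmul_qreal_comm _ I). reflexivity.
Qed.

(** The map sending u to I u I is an involution because I^2 = -1 enters twice, so averaging with it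
    is a projection. *)
Lemma anti_idempotent (I : quat) (f : quat -> quat) : in_S I -> anti I (anti I f) = anti I f.
Proof.
  intros HI. apply functional_extensionality. intros q. unfold anti.
  assert (E : forall u, I * (qreal (1 / 2) * u) * I = qreal (1 / 2) * (I * u * I)).
  { intros u. rewrite (qmul_assoc I), <- (qmul_qreal_comm _ I), !qmul_assoc. reflexivity. }
  assert (E2 : I * (f q + I * f q * I) * I = I * f q * I + f q).
  { rewrite qmul_plus_r, qmul_plus_l. f_equal.
    rewrite !qmul_assoc, HI, <- qmul_assoc, HI. generalize (f q). quat_ring. }
  rewrite E, E2. quat_linear.
Qed.

(** The term I (I f') g cancels f' g, and half of f g' + I f I g' is [anti I f] times g'. *)
Lemma dbar_ambient_qmul (I : quat) (f g : quat -> quat) (x y : R) : in_S I ->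
  left_holomorphic I f -> left_holomorphic I g ->
  dbar_ambient I (fun q => f q * g q) (slice_point I x y)
  = anti I f (slice_point I x y) * dir_deriv q1 g (slice_point I x y).
Proof.
  intros HI [Sf Hf] [Sg Hg]. unfold dbar_ambient, anti.
  rewrite !dir_deriv_qmul by assumption. rewrite Hf, Hg.
  generalize (f (slice_point I x y)), (g (slice_point I x y)),
    (dir_deriv q1 f (slice_point I x y)), (dir_deriv q1 g (slice_point I x y)).
  intros a b a' b'. rewrite <- (qmul_assoc (qreal (1 / 2))). f_equal.
  rewrite (qmul_plus_r I), (qmul_plus_l a), !qmul_assoc, HI, <- (qmul_assoc _ a' b).
  quat_linear.
Qed.

Lemma polyholomorphic_qmul (I : quat) (k : nat) (f g : quat -> quat) : in_S I ->
  entire f -> entire g ->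
  (forall x y, anti I f (slice_point I x y)
     * Nat.iter (S k) (dir_deriv q1) g (slice_point I x y) = zero) ->
  polyholomorphic I (S k) (fun q => f q * g q).
Proof.
  intros HI Hf Hg H.
  assert (Lf : left_holomorphic I f) by (apply entire_left_holomorphic, Hf).
  assert (Sgen : forall a b : quat -> quat, left_holomorphic I a -> entire b ->
    smooth (fun q => a q * b q)).
  { intros a b Ha Hb. apply smooth_qmul; [apply Ha | apply entire_smooth, Hb]. }
  (* The left factor is f at the first step and [anti I f] from then on; generalising to any a with
     the same anticommuting part covers both. *)
  assert (Hstep : forall k a g, left_holomorphic I a -> anti I a = anti I f -> entire g ->
    (forall x y, anti I f (slice_point I x y)
       * Nat.iter (S k) (dir_deriv q1) g (slice_point I x y) = zero) ->
    polyholomorphic I (S k) (fun q => a q * g q)).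
  { clear k g Hg H. induction k as [|k IH]; intros a g La Ea Hg H.
    - apply (polyholomorphic_S I 0 _ (fun q => anti I f q * dir_deriv q1 g q)).
      + apply Sgen; assumption.
      + apply slice_eq. intros x y. rewrite dbar_ambient_qmul, Ea;
          auto using entire_left_holomorphic.
      + unfold polyholomorphic. simpl. apply slice_eq. exact H.
    - apply (polyholomorphic_S I (S k) _ (fun q => anti I f q * dir_deriv q1 g q)).
      + apply Sgen; assumption.
      + apply slice_eq. intros x y. rewrite dbar_ambient_qmul, Ea;
          auto using entire_left_holomorphic.
      + apply IH.
        * apply left_holomorphic_anti, Lf.
        * apply anti_idempotent, HI.
        * apply entire_dir_deriv_1, Hg.
        * intros x y. specialize (H x y). rewrite Nat.iter_succ_r in H. exact H. }
  apply Hstep; auto.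
Qed.

Lemma smooth_sum_n (a : nat -> quat -> quat) (N : nat) :
  (forall n, (n <= N)%nat -> smooth (a n)) -> smooth (fun q => sum_n (fun n => a n q) N).
Proof.
  induction N as [|N IH]; intros Ha.
  - replace (fun q => sum_n (fun n => a n q) 0) with (a O); [apply Ha; lia|].
    apply functional_extensionality. intros q. rewrite sum_O. reflexivity.
  - replace (fun q => sum_n (fun n => a n q) (S N))
      with (fun q => sum_n (fun n => a n q) N + a (S N) q).
    + apply smooth_plus; [apply IH; intros; apply Ha; lia | apply Ha; lia].
    + apply functional_extensionality. intros q. rewrite sum_Sn. reflexivity.
Qed.

Lemma polyholomorphic_sum_n (I : quat) (k : nat) (a : nat -> quat -> quat) (N : nat) :
  (forall n, (n <= N)%nat -> smooth (a n) /\ polyholomorphic I k (a n)) ->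
  polyholomorphic I k (fun q => sum_n (fun n => a n q) N).
Proof.
  induction N as [|N IH]; intros Ha.
  - replace (fun q => sum_n (fun n => a n q) 0) with (a O); [apply Ha; lia|].
    apply functional_extensionality. intros q. rewrite sum_O. reflexivity.
  - replace (fun q => sum_n (fun n => a n q) (S N))
      with (fun q => sum_n (fun n => a n q) N + a (S N) q).
    + apply polyholomorphic_plus.
      * apply smooth_sum_n. intros n Hn. apply Ha. lia.
      * apply Ha. lia.
      * apply IH. intros n Hn. apply Ha. lia.
      * apply Ha. lia.
    + apply functional_extensionality. intros q. rewrite sum_Sn. reflexivity.
Qed.

(** The common criterion for all three cases. A product has order k0 + 1 and the conjugate adds j +
    k <= m + n, so every term has order m + n + k0 + 1, that is, level m + n + k0. *)
Lemma odotLsp_polyregular (m n k0 : nat) (phi psi : nat -> quat -> quat) :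
  (forall j, (j <= m)%nat -> entire (phi j)) ->
  (forall k, (k <= n)%nat -> entire (psi k)) ->
  (forall j k I x y, (j <= m)%nat -> (k <= n)%nat -> in_S I ->
     anti I (phi j) (slice_point I x y)
     * Nat.iter (S k0) (dir_deriv q1) (psi k) (slice_point I x y) = zero) ->
  S_polyregular (odotLsp m n phi psi).
Proof.
  intros Hphi Hpsi H.
  assert (Hterm : forall j k, (j <= m)%nat -> (k <= n)%nat ->
    smooth (fun q => qpow (qconj q) (j + k) * phi j q * psi k q) /\
    forall I, in_S I -> polyholomorphic I (S (m + n + k0))
      (fun q => qpow (qconj q) (j + k) * phi j q * psi k q)).
  { intros j k Hj Hk.
    assert (Sprod : smooth (fun q => phi j q * psi k q))
      by (apply smooth_qmul; apply entire_smooth; auto).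
    replace (fun q => qpow (qconj q) (j + k) * phi j q * psi k q)
      with (fun q => qpow (qconj q) (j + k) * (phi j q * psi k q)).
    2:{ apply functional_extensionality. intros q. apply qmul_assoc. }
    split.
    - apply smooth_qmul; [apply smooth_qpow, smooth_qconj | exact Sprod].
    - intros I HI. apply (polyholomorphic_weaken I (j + k + S k0)); [lia|].
      apply polyholomorphic_qpow_qconj_mul; [exact HI | exact Sprod |].
      apply polyholomorphic_qmul; auto. }
  exists (m + n + k0)%nat. split.
  - apply (smooth_sum_n (fun j q => sum_n (fun k =>
      qpow (qconj q) (j + k) * phi j q * psi k q) n)).
    intros j Hj.
    apply (smooth_sum_n (fun k q => qpow (qconj q) (j + k) * phi j q * psi k q)).
    intros k Hk. apply Hterm; assumption.
  - intros I HI x y.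
    assert (P : polyholomorphic I (S (m + n + k0)) (odotLsp m n phi psi)).
    { apply (polyholomorphic_sum_n I _ (fun j q => sum_n (fun k =>
        qpow (qconj q) (j + k) * phi j q * psi k q) n)).
      intros j Hj. split.
      - apply (smooth_sum_n (fun k q => qpow (qconj q) (j + k) * phi j q * psi k q)).
        intros k Hk. apply Hterm; assumption.
      - apply (polyholomorphic_sum_n I _
          (fun k q => qpow (qconj q) (j + k) * phi j q * psi k q)).
        intros k Hk. split; [|intros]; apply Hterm; assumption. }
    unfold polyholomorphic in P. rewrite P. reflexivity.
Qed.

(** * The three cases *)

Lemma dir_deriv_right_polynomial (f : quat -> quat) (M : nat) (beta : nat -> quat) :
  (forall q, f q = sum_n (fun l => qpow q l * beta l) M) ->
  Nat.iter (S M) (dir_deriv q1) f = (fun _ => zero).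
Proof.
  revert f beta. induction M as [|M IH]; intros f beta Hf.
  - replace f with (fun _ : quat => beta O).
    + exact (dir_deriv_const (beta O) q1).
    + apply functional_extensionality. intros q. rewrite Hf, sum_O. symmetry. apply qmul_1_l.
  - rewrite Nat.iter_succ_r.
    (* The derivative along the real axis is the polynomial of degree bound M with coefficients (l +
       1) beta_(l+1). *)
    apply (IH _ (fun l => scal (INR (S l)) (beta (S l)))). intros q.
    assert (Sterm : forall l, smooth (fun q => qpow q l * beta l)).
    { intros l. apply smooth_qmul; [apply smooth_qpow, smooth_id | apply smooth_const]. }
    assert (Hsum : forall N, dir_deriv q1 (fun q => sum_n (fun l => qpow q l * beta l) (S N)) q
      = sum_n (fun l => qpow q l * scal (INR (S l)) (beta (S l))) N).
    { assert (Hterm : forall l, dir_deriv q1 (fun q => qpow q l * beta l) q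
                              = scal (INR l) (qpow q (pred l)) * beta l).
      { intros l. rewrite dir_deriv_qmul_const_r by auto using smooth_qpow, smooth_id.
        rewrite dir_deriv_qpow_comm by (unfold q1; symmetry; apply qmul_qreal_comm).
        unfold q1. rewrite qmul_1_l. reflexivity. }
      assert (Hsplit : forall N, dir_deriv q1 (fun q => sum_n (fun l => qpow q l * beta l) (S N)) q
        = dir_deriv q1 (fun q => sum_n (fun l => qpow q l * beta l) N) q
          + dir_deriv q1 (fun q => qpow q (S N) * beta (S N)) q).
      { intros N.
        replace (fun q => sum_n (fun l => qpow q l * beta l) (S N))
          with (fun q => sum_n (fun l => qpow q l * beta l) N + qpow q (S N) * beta (S N)).
        - rewrite dir_deriv_plus; [reflexivity | | apply Sterm].
          apply (smooth_sum_n (fun l q => qpow q l * beta l)). intros; apply Sterm.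
        - apply functional_extensionality. intros q'. rewrite sum_Sn. reflexivity. }
      induction N as [|N IHN].
      - rewrite Hsplit, sum_O, Hterm. simpl Nat.pred.
        replace (fun q => sum_n (fun l => qpow q l * beta l) 0) with (fun _ : quat => beta O).
        + rewrite dir_deriv_const, qmul_scal_l, qmul_scal_r.
          apply (@plus_zero_l quat_NM).
        + apply functional_extensionality. intros q'. rewrite sum_O. symmetry. apply qmul_1_l.
      - rewrite Hsplit, IHN, Hterm, sum_Sn. simpl Nat.pred.
        rewrite qmul_scal_l, qmul_scal_r. reflexivity. }
    rewrite <- Hsum. f_equal. apply functional_extensionality. exact Hf.
Qed.

Lemma iter_dir_deriv_const_zero (v : quat) (k k' : nat) (f : quat -> quat) :
  (k <= k')%nat -> Nat.iter k (dir_deriv v) f = (fun _ => zero) ->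
  Nat.iter k' (dir_deriv v) f = (fun _ => zero).
Proof.
  intros Hk H. induction Hk as [|k' Hk IH]; [exact H|].
  simpl. rewrite IH. apply dir_deriv_const.
Qed.

Lemma right_polynomial_bound (n : nat) (psi : nat -> quat -> quat) :
  (forall k, (k <= n)%nat -> right_polynomial (psi k)) ->
  exists M, forall k, (k <= n)%nat ->
    Nat.iter (S M) (dir_deriv q1) (psi k) = (fun _ => zero).
Proof.
  intros H. induction n as [|n IH].
  - destruct (H O (le_n _)) as (M & beta & Hb). exists M. intros k Hk.
    replace k with O by lia. eapply dir_deriv_right_polynomial, Hb.
  - destruct IH as [M HM]; [intros; apply H; lia|].
    destruct (H (S n) (le_n _)) as (M' & beta & Hb).
    exists (Nat.max M M'). intros k Hk.
    destruct (Nat.eq_dec k (S n)) as [->|Hne].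
    + apply (iter_dir_deriv_const_zero _ (S M')); [lia|].
      eapply dir_deriv_right_polynomial, Hb.
    + apply (iter_dir_deriv_const_zero _ (S M)); [lia|]. apply HM. lia.
Qed.

Lemma anti_in_CI (I : quat) (f : quat -> quat) (q : quat) : in_S I ->
  in_CI I (f q) -> anti I f q = zero.
Proof.
  intros HI (x & y & E). unfold anti. rewrite E.
  rewrite <- slice_point_comm, <- qmul_assoc, HI. generalize (slice_point I x y). quat_ring.
Qed.

(** * The splitting on a slice *)

Lemma in_CI_of_comm (I q : quat) : in_S I -> I * q = q * I -> in_CI I q.
Proof.
  intros HI Hc. destruct (in_S_inv I HI) as [I0 I1].
  (* The coordinates of the orthogonal projection of q onto C_I. *)
  exists (qre q), (qdot q I). apply qdot_eq. intros r.
  (* I q I = |I|^2 (q - 2 Re q) - 2 <q, I> I for purely imaginary I *)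
  assert (E : I * q * I = scal (qdot I I) (q + qreal (- (2 * qre q))) + scal (- (2 * qdot q I)) I).
  { clear - I0. destruct I as [[[a b] c] d].
    unfold qre in I0; simpl in I0. subst a. quat_ring. }
  rewrite Hc, <- qmul_assoc, HI, <- qmul_qreal_comm in E.
  apply (f_equal (fun p => qdot p r)) in E. unfold slice_point.
  rewrite qmul_qreal_l, I1, !qdot_plus_l, !qdot_scal_l, !qdot_plus_l in E.
  rewrite qdot_plus_l, qdot_scal_l.
  assert (Er : forall x, qdot (qreal x) r = (x * qre r)%R) by (intros; quat_ring).
  rewrite !Er in *. lra.
Qed.

(** [holomorphic_CI] asks for total differentiability; it is shown for each real functional by a
    continuous partial derivative and reassembled from the basis. *)
Lemma ex_filterdiff_slice (I : quat) (f : quat -> quat) (x y : R) : smooth f ->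
  ex_filterdiff (fun p : R * R => slice I f (fst p) (snd p)) (locally (x, y)).
Proof.
  intros Hf.
  set (h := fun p : R * R => slice I f (fst p) (snd p)).
  assert (Hr : forall r, exists l : R * R -> R,
    filterdiff (fun p : R * R => qdot (h p) r) (locally (x, y)) l).
  { intros r. eexists.
    apply (is_derive_filterdiff (fun x y => qdot (slice I f x y) r) x y
      (fun x y => qdot (dir_deriv q1 f (slice_point I x y)) r)
      (qdot (dir_deriv I f (slice_point I x y)) r)).
    - apply filter_forall. intros [s t].
      apply (proj1 (is_derive_qdot _ _ _)), is_derive_slice_x, smooth_is_derive_0, Hf.
    - apply (proj1 (is_derive_qdot _ _ _)), is_derive_slice_y, smooth_is_derive_0, Hf.
    - apply (continuous_comp (fun z : R * R => slice_point I (fst z) (snd z))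
        (fun q => qdot (dir_deriv q1 f q) r) (x, y)); [apply continuous_slice_point|].
      apply (proj1 (continuous_qdot _ _)), smooth_continuous, smooth_dir_deriv, Hf. }
  assert (Hs : forall r, exists l : R * R -> quat,
    filterdiff (fun p : R * R => scal (qdot (h p) r) r) (locally (x, y)) l).
  { intros r. destruct (Hr r) as [l Hl]. eexists.
    apply (@filterdiff_comp' R_AbsRing (prod_NormedModule R_AbsRing R_NormedModule R_NormedModule)
      R_NormedModule quat_NM (fun p => qdot (h p) r) (fun s => scal s r) (x, y)); [exact Hl|].
    apply filterdiff_linear, (@is_linear_scal_l R_AbsRing quat_NM). }
  assert (Hplus : forall g g' : R * R -> quat,
    (exists l : R * R -> quat, filterdiff g (locally (x, y)) l) ->
    (exists l : R * R -> quat, filterdiff g' (locally (x, y)) l) ->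
    exists l : R * R -> quat, filterdiff (fun p => g p + g' p) (locally (x, y)) l).
  { intros g g' [l Hl] [l' Hl']. exists (fun p => l p + l' p).
    exact (@filterdiff_plus_fct R_AbsRing
      (prod_NormedModule R_AbsRing R_NormedModule R_NormedModule) quat_NM
      (locally (x, y)) _ g g' l l' Hl Hl'). }
  destruct (Hplus _ _ (Hplus _ _ (Hplus _ _ (Hs q1) (Hs qi)) (Hs qj)) (Hs qk)) as [l Hl].
  exists l.
  eapply (@filterdiff_ext R_AbsRing (prod_NormedModule R_AbsRing R_NormedModule R_NormedModule)
    quat_NM); [apply locally_filter | | exact Hl].
  intros p. symmetry. apply quat_decompose.
Qed.

Lemma left_holomorphic_holomorphic_CI (I : quat) (f : quat -> quat) : in_S I ->
  left_holomorphic I f -> (forall x y, in_CI I (f (slice_point I x y))) ->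
  holomorphic_CI I (slice I f).
Proof.
  intros HI [Sf Hf] Hin. split; [exact Hin | split].
  - intros x y. apply ex_filterdiff_slice, Sf.
  - intros x y. rewrite dbar_slice by exact Sf. unfold slice, dbar_ambient.
    rewrite Hf, qmul_assoc, HI. generalize (dir_deriv q1 f (slice_point I x y)). quat_ring.
Qed.

Lemma exists_perp (I : quat) : in_S I -> exists J, in_S J /\ perp I J.
Proof.
  intros HI. destruct (in_S_inv I HI) as [I0 I1].
  destruct I as [[[a b] c] d]. unfold qre in I0; simpl in I0. subst a.
  unfold qdot, qre, qim_i, qim_j, qim_k in I1; simpl in I1.
  assert (HJ : forall s b' c' d' : R, (s * s = b' * b' + c' * c' + d' * d')%R -> s <> 0 ->
    (b * b' + c * c' + d * d' = 0)%R ->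
    exists J, in_S J /\ perp (0, b, c, d) J).
  { intros s b' c' d' Hs Hs0 Hp.
    exists (0, (b' / s)%R, (c' / s)%R, (d' / s)%R). split.
    - unfold in_S, qmul, qreal, qre, qim_i, qim_j, qim_k; simpl.
      repeat apply (f_equal2 pair); try (field; assumption).
      transitivity (- (b' * b' + c' * c' + d' * d') / (s * s))%R; [field; assumption|].
      rewrite <- Hs. field. assumption.
    - unfold perp, qdot, qre, qim_i, qim_j, qim_k; simpl.
      transitivity ((b * b' + c * c' + d * d') / s)%R; [field; assumption|].
      rewrite Hp. field. assumption. }
  (* If I is a multiple of k, then i is orthogonal to it; otherwise the vector (- c, b, 0) is
     orthogonal to I and nonzero, and [HJ] normalises it. *)
  destruct (Req_dec (b * b + c * c) 0) as [H0|H0].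
  - apply (HJ 1 1 0 0)%R; [ring | lra | nra].
  - apply (HJ (sqrt (b * b + c * c)) (- c) b 0)%R.
    + rewrite sqrt_sqrt by nra. ring.
    + intros E. apply sqrt_eq_0 in E; nra.
    + ring.
Qed.

(** For purely imaginary I and J, I J + J I = - 2 <I, J>. *)
Lemma perp_anticomm (I J : quat) : in_S I -> in_S J -> perp I J -> I * J = qreal (-1) * (J * I).
Proof.
  intros HI HJ HIJ. destruct (in_S_inv I HI) as [I0 _], (in_S_inv J HJ) as [J0 _].
  assert (E : I * J + J * I = qreal (- (2 * qdot I J))).
  { clear - I0 J0. destruct I as [[[a b] c] d], J as [[[a' b'] c'] d'].
    unfold qre in I0, J0; simpl in I0, J0. subst a a'. quat_ring. }
  unfold perp in HIJ. rewrite HIJ in E. apply qdot_eq. intros r.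
  apply (f_equal (fun p => qdot p r)) in E.
  rewrite qdot_plus_l in E. rewrite qmul_qreal_l, qdot_scal_l.
  replace (qreal (- (2 * 0))) with (zero : quat) in E.
  - rewrite qdot_zero_l in E. lra.
  - unfold qreal. replace (- (2 * 0))%R with 0 by ring. reflexivity.
Qed.

Lemma anti_anticomm (I : quat) (f : quat -> quat) (q : quat) : in_S I ->
  I * anti I f q = qreal (-1) * (anti I f q * I).
Proof.
  intros HI. unfold anti.
  rewrite !(qmul_assoc I (qreal (1 / 2))), <- !(qmul_qreal_comm (1 / 2) I).
  rewrite <- !(qmul_assoc (qreal (1 / 2))), (qmul_assoc (qreal (-1))),
    (qmul_qreal_comm (-1) (qreal (1 / 2))), <- (qmul_assoc (qreal (1 / 2)) (qreal (-1))).
  f_equal. rewrite qmul_plus_l, qmul_plus_r.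
  rewrite <- (qmul_assoc (I * f q) I I), HI, !(qmul_assoc I), HI, <- (qmul_qreal_comm (-1)).
  rewrite <- (qmul_assoc (qreal (-1)) (f q) I).
  quat_linear.
Qed.

Lemma anticomm_mul (I p q : quat) :
  I * p = qreal (-1) * (p * I) -> I * q = qreal (-1) * (q * I) -> I * (p * q) = p * q * I.
Proof.
  intros Hp Hq.
  rewrite qmul_assoc, Hp, <- (qmul_assoc (qreal (-1)) (p * I)), <- (qmul_assoc p I), Hq,
    (qmul_assoc p (qreal (-1))), <- (qmul_qreal_comm (-1) p),
    <- (qmul_assoc (qreal (-1)) p), (qmul_assoc p q).
  generalize (p * q * I). quat_ring.
Qed.

Lemma left_holomorphic_mul_const_r (I c : quat) (f : quat -> quat) :
  left_holomorphic I f -> left_holomorphic I (fun q => f q * c).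
Proof.
  intros [Sf Hf]. split.
  - apply smooth_qmul; [exact Sf | apply smooth_const].
  - intros x y. rewrite !dir_deriv_qmul_const_r, Hf by exact Sf. symmetry. apply qmul_assoc.
Qed.

(** Since G J must be the anticommuting part and J^2 = -1, G is that part times - J. Both factors
    anticommute with I, so G commutes with I and takes values in C_I. *)
Lemma anti_splitting (I J : quat) (f : quat -> quat) : in_S I -> in_S J -> perp I J ->
  entire f ->
  splitting I J f (slice I (commuting_part I f))
    (slice I (fun q => anti I f q * (qreal (-1) * J))).
Proof.
  intros HI HJ HIJ Hf.
  assert (Lf : left_holomorphic I f) by (apply entire_left_holomorphic, Hf).
  split; [|split].
  - apply left_holomorphic_holomorphic_CI; [exact HI | apply left_holomorphic_commuting_part, Lf|].
    intros x y. apply in_CI_of_comm; [exact HI|]. unfold commuting_part.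
    generalize (f (slice_point I x y)). intros u.
    rewrite (qmul_assoc I (qreal (1 / 2))), <- (qmul_qreal_comm (1 / 2) I),
      <- !(qmul_assoc (qreal (1 / 2))).
    f_equal.
    assert (E : qreal (-1) * I * u * I = qreal (-1) * (I * u * I))
      by (rewrite <- !qmul_assoc; reflexivity).
    assert (E1 : I * (I * u * I) = qreal (-1) * (u * I))
      by (rewrite !qmul_assoc, HI; reflexivity).
    assert (E2 : I * u * I * I = qreal (-1) * (I * u))
      by (rewrite <- (qmul_assoc (I * u) I I), HI, <- qmul_qreal_comm; reflexivity).
    rewrite E, qmul_plus_r, qmul_plus_l, (qmul_assoc I (qreal (-1))),
      <- (qmul_qreal_comm (-1) I), <- (qmul_assoc (qreal (-1)) I), E1,
      <- (qmul_assoc (qreal (-1)) (I * u * I) I), E2.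
    quat_linear.
  - apply left_holomorphic_holomorphic_CI; [exact HI| |].
    + apply left_holomorphic_mul_const_r, left_holomorphic_anti, Lf.
    + intros x y. apply in_CI_of_comm; [exact HI|].
      apply anticomm_mul; [apply anti_anticomm, HI|].
      rewrite (qmul_assoc I (qreal (-1))), <- (qmul_qreal_comm (-1) I),
        <- (qmul_assoc (qreal (-1)) I), (perp_anticomm I J) by assumption.
      f_equal. apply qmul_assoc.
  - intros x y. unfold slice, commuting_part, anti.
    rewrite <- (qmul_assoc _ _ J), <- (qmul_assoc _ J J), HJ.
    replace (qreal (-1) * qreal (-1)) with (qreal 1) by quat_ring.
    rewrite qmul_1_r, <- (qmul_assoc (qreal (-1)) I), <- (qmul_assoc (qreal (-1))).
    quat_linear.
Qed.

Lemma qmul_eq_zero (p q : quat) : p * q = zero -> p = zero \/ q = zero.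
Proof.
  intros H. apply (f_equal (fun x : quat => norm x)) in H. cbv beta in H.
  rewrite norm_qmul in H.
  assert (N0 : norm (zero : quat) = 0) by apply (@norm_zero R_AbsRing quat_NM).
  rewrite N0 in H. apply Rmult_integral in H.
  destruct H as [H|H]; [left|right]; apply (@norm_eq_zero R_AbsRing quat_NM), H.
Qed.

Lemma in_S_neq_zero (I : quat) : in_S I -> I <> zero.
Proof.
  intros HI E. destruct (in_S_inv I HI) as [_ I1]. rewrite E, qdot_zero_l in I1. lra.
Qed.

(** By the Cauchy-Riemann equation each y-derivative is I times the derivative along the real
    axis. *)
Lemma iter_partial_y_slice (I : quat) (k : nat) (f : quat -> quat) : entire f ->
  Nat.iter k partial_y (slice I f) =
  slice I (fun q => qpow I k * Nat.iter k (dir_deriv q1) f q).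
Proof.
  intros Hf. induction k as [|k IH].
  - simpl. apply slice_eq. intros x y. symmetry. apply qmul_1_l.
  - assert (He : entire (Nat.iter k (dir_deriv q1) f)).
    { clear IH. induction k as [|k IH]; [exact Hf | apply entire_dir_deriv_1, IH]. }
    assert (Se : smooth (Nat.iter k (dir_deriv q1) f)) by apply entire_smooth, He.
    simpl Nat.iter at 1. rewrite IH, partial_y_slice.
    + apply slice_eq. intros x y. rewrite dir_deriv_qmul_const_l by exact Se.
      rewrite (proj2 (entire_left_holomorphic _ I He) x y). simpl.
      rewrite qmul_assoc. f_equal.
      clear. induction k as [|k IH]; simpl.
      * rewrite qmul_1_l, qmul_1_r. reflexivity.
      * rewrite <- qmul_assoc, IH. reflexivity.
    + apply smooth_qmul; [apply smooth_const | exact Se].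
Qed.

Lemma qpow_neq_zero (q : quat) (k : nat) : q <> zero -> qpow q k <> zero.
Proof.
  intros Hq. induction k as [|k IH]; simpl.
  - intros E. apply (f_equal qre) in E. unfold qreal, qre in E. simpl in E.
    apply R1_neq_R0. exact E.
  - intros E. apply qmul_eq_zero in E. tauto.
Qed.

(** The hypothesis has - J and I^k standing between the two factors of interest, where they cannot
    be cancelled by commuting. As H has no zero divisors, at each point one of the two outer factors
    already vanishes. *)
Lemma anti_mul_eq_zero (I J : quat) (k : nat) (f g : quat -> quat) (x y : R) :
  in_S I -> in_S J -> entire g ->
  slice I (fun q => anti I f q * (qreal (-1) * J)) x y
    * Nat.iter k partial_y (slice I g) x y = zero ->
  anti I f (slice_point I x y) * Nat.iter k (dir_deriv q1) g (slice_point I x y) = zero.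
Proof.
  intros HI HJ Hg H. rewrite iter_partial_y_slice in H by exact Hg. unfold slice in H.
  assert (H1 : qreal (-1) <> zero).
  { intros E. apply (f_equal qre) in E. unfold qreal, qre in E. simpl in E.
    unfold zero in E; simpl in E. lra. }
  apply qmul_eq_zero in H. destruct H as [H|H].
  - apply qmul_eq_zero in H. destruct H as [H|H]; [rewrite H; apply qmul_zero_l|].
    apply qmul_eq_zero in H. destruct H as [H|H]; [contradiction|].
    exfalso. exact (in_S_neq_zero J HJ H).
  - apply qmul_eq_zero in H. destruct H as [H|H]; [|rewrite H; apply qmul_zero_r].
    exfalso. exact (qpow_neq_zero I k (in_S_neq_zero I HI) H).
Qed.

Theorem theorem4p1 (m n : nat) (phi psi : nat -> quat -> quat)
  (f g : quat -> quat)
  (Hphi : forall j : nat, (j <= m)%nat -> slice_regular (phi j))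
  (Hpsi : forall k : nat, (k <= n)%nat -> slice_regular (psi k))
  (Hf : forall q : quat, f q = polyreg_sum m phi q)
  (Hg : forall q : quat, g q = polyreg_sum n psi q)
  (HfSR : SR m f)
  (HgSR : SR n g) :
  ((forall k : nat, (k <= n)%nat -> right_polynomial (psi k)) ->
   S_polyregular (odotLsp m n phi psi)) /\
  ((forall I : quat, in_S I -> forall j : nat, (j <= m)%nat ->
    forall x y : R, in_CI I (slice I (phi j) x y)) ->
   S_polyregular (odotLsp m n phi psi)) /\
  ((exists k0 : nat, (0 < k0)%nat /\
    forall j k : nat, (j <= m)%nat -> (k <= n)%nat ->
    forall I J : quat, in_S I -> in_S J -> perp I J ->
    forall F G : R -> R -> quat, splitting I J (phi j) F G ->
    forall x y : R,
      (G x y * Nat.iter k0 partial_y (slice I (psi k)) x y)%H = zero) ->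
   S_polyregular (odotLsp m n phi psi)).
Proof.
  assert (Ephi : forall j, (j <= m)%nat -> entire (phi j))
    by (intros; apply slice_regular_entire; auto).
  assert (Epsi : forall k, (k <= n)%nat -> entire (psi k))
    by (intros; apply slice_regular_entire; auto).
  split; [|split].
  - intros Hpoly. destruct (right_polynomial_bound n psi Hpoly) as [M HM].
    apply (odotLsp_polyregular m n M); auto.
    intros j k I x y Hj Hk HI. rewrite HM by exact Hk. apply qmul_zero_r.
  (* With a vanishing anticommuting part the products are already left holomorphic on the slice,
     hence k0 = 0. *)
  - intros Hin. apply (odotLsp_polyregular m n 0); auto.
    intros j k I x y Hj Hk HI.
    rewrite anti_in_CI; [apply qmul_zero_l | exact HI | apply Hin; assumption].
  (* The criterion counts derivatives as [S k0], so positivity of k0 supplies the predecessor. *)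
  - intros (k0 & Hk0 & H). destruct k0 as [|k0]; [lia|].
    apply (odotLsp_polyregular m n k0); auto.
    intros j k I x y Hj Hk HI.
    destruct (exists_perp I HI) as (J & HJ & HIJ).
    apply (anti_mul_eq_zero I J); auto.
    (* The hypothesis ranges over all splittings and all J; one explicit instance is enough. *)
    apply (H j k Hj Hk I J HI HJ HIJ _ _ (anti_splitting I J (phi j) HI HJ HIJ (Ephi j Hj))).
Qed.
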